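(* For every trade-off parameter $s \in (0,1]$, define \[ \rho(s):=\frac{e^s}{s} \quad\text{and}\quad \chi(s):=\begin{cases} (e^s-1)/s, & 0< s < \ln 2, \\ \xi(s)/s, & \ln 2 \leq s \leq 1, \end{cases} \] where, for $s\in[\ln 2,1]$, $\xi(s)$ is the unique solution $\xi\in[1,e]$ of $\xi(2-\ln \xi)=e^s$. Then for every $s\in(0,1]$ there exists a randomized $\rho(s)$-robust $\chi(s)$-consistent online bidding algorithm (strategy). Moreover, the pair $(\rho(s),\chi(s))$ is Pareto-optimal: there is no $\rho'$-robust $\chi(s)$-consistent randomized strategy with $\rho'<\rho(s)$.
   Context: Online bidding: there is an unknown target $T>0$; a bidder submits strictly increasing positive bids until a bid of value at least $T$ is submitted; the cost is the sum of all submitted bids up to and including the first bid $\ge T$. A prediction $P>0$ of $T$ is given; by scale invariance it is normalized to $P=1$. Algorithms are modeled by strategies: a deterministic strategy is a bi-infinite sequence $b=(b_n)_{n\in\mathbb{Z}}$ with $0<\cdots<b_{-1}<b_0<b_1<\cdots$, and its cost on target $T>0$ is $\mathrm{cost}_b(T):=\sum_{n\le n_*} b_n$ where $n_*:=\min\{n\in\mathbb{Z}: b_n\ge T\}$. A randomized strategy $B$ is a probability distribution over deterministic strategies, and $\mathrm{cost}_B(T)$ denotes its expected cost. $B$ is $\chi$-consistent if $\mathrm{cost}_B(1)\le \chi$ and $\rho$-robust if $\mathrm{cost}_B(T)\le \rho T$ for every $T>0$. A pair $(\rho,\chi)$ is Pareto-optimal if there is a $\rho$-robust $\chi$-consistent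 strategy but no $\rho'$-robust $\chi$-consistent strategy for any $\rho'<\rho$. *)

(* Defs.v *)
From HB Require Import structures.
From mathcomp Require Import all_boot all_order all_algebra.
From mathcomp Require Import all_classical all_reals all_analysis.
Set Implicit Arguments. Unset Strict Implicit. Unset Printing Implicit Defensive.
Import Order.TTheory GRing.Theory Num.Theory.
Local Open Scope classical_set_scope.
Local Open Scope ring_scope.

Section OnlineBidding.
Context {R : realType}.

Definition strategy (b : int -> R) : Prop :=
  (forall n : int, 0 < b n) /\ (forall n : int, b n < b (n + 1)).

(* n_* := min { n : b_n >= T } (picked classically; meaningful when it exists) *)
Definition is_nstar (b : int -> R) (T : R) (n : int) : Prop :=
  T <= b n /\ (forall m : int, T <= b m -> n <= m).

Definition nstar (b : int -> R) (T : R) : int := xget 0 (is_nstar b T).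

Definition cost (b : int -> R) (T : R) : \bar R :=
  if `[< exists n, is_nstar b T n >]
  then (\esum_(n in [set n : int | (n <= nstar b T)%R]) (b n)%:E)%E
  else +oo%E.

Definition rand_strategy {d} {Omega : measurableType d}
  (b : Omega -> int -> R) : Prop :=
  (forall w, strategy (b w)) /\
  (forall n : int, measurable_fun setT (fun w => b w n)).

Definition rand_cost {d} {Omega : measurableType d} (P : probability Omega R)
  (b : Omega -> int -> R) (T : R) : \bar R :=
  (\int[P]_w cost (b w) T)%E.

Definition robust {d} {Omega : measurableType d} (P : probability Omega R)
  (b : Omega -> int -> R) (rho : R) : Prop :=
  forall T : R, 0 < T -> (rand_cost P b T <= (rho * T)%:E)%E.

Definition consistent {d} {Omega : measurableType d} (P : probability Omega R)
  (b : Omega -> int -> R) (chi : R) : Prop :=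
  (rand_cost P b 1 <= chi%:E)%E.

Definition rho_s (s : R) : R := expR s / s.

Definition xi_s (s : R) : R :=
  xget 1 [set x : R | 1 <= x <= expR 1 /\ x * (2 - ln x) = expR s].

Definition chi_s (s : R) : R :=
  if s < ln 2 then (expR s - 1) / s else xi_s s / s.

End OnlineBidding.

(* Main.v *)
Require Import Defs.
From HB Require Import structures.
From mathcomp Require Import all_boot all_order all_algebra.
From mathcomp Require Import all_classical all_reals all_analysis.
From mathcomp Require Import measurable_realfun zify ring lra.
Import Order.TTheory GRing.Theory Num.Theory.
Import numFieldNormedType.Exports.
Local Open Scope classical_set_scope.
Local Open Scope ring_scope.
Set Implicit Arguments.
Unset Strict Implicit.
Unset Printing Implicit Defensive.

(* Index the bids of a randomized strategy by their expected rank and let [H t]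
   be the expected total of the bids of rank at most [t]. Then [H' t] is the bid
   of rank [t], the expected cost on target [H' t] is at least [H (t + 1)], with
   equality for the strategy bidding [H' (n + U)], [U] uniform on [0, 1].
   So [rho]-robustness is the delay inequality [H (t + 1) <= rho * H' t], and if
   rank [0] corresponds to the bid [1] the consistency is [H 1].

   Write [rho = e^s / s]. The inequality makes [e^(- s t) H t] nondecreasing, and
   [I t = e^(- s t) H t - s (integral of e^(- s u) H u over [t, t + 1])]
   is nondecreasing and nonnegative. [I 0 >= 0] reads
   [e^(- s) H 1 >= integral of e^(- s u) H' u over [0, 1]], where both [H' u >= 1]
   and [H' u >= s e^(- s) H (u + 1) >= s e^(s (u - 1)) H 1]; solving for [H 1]
   gives [chi_s s]. For the lower bound the argument is run on a grid of step
   [1 / N], the slack [rho' < rho] absorbing the discretization error.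

   Equality forces [H' u = max 1 (e^(s (u - tau)))] for [u >= 0] and the delay
   equation [H' t = H (t + 1) / rho] for [t < 0], which is solved backwards in
   pieces of length one; [I = 0] keeps the solution positive. *)

(** * Lower bounds for solutions of the delay inequality *)

Section DelayInequality.
Context {R : realType}.
Implicit Types (H : R -> R) (s rho t d : R).

Lemma one_sub_expRN_le (x : R) : 1 - expR (- x) <= x.
Proof. by have := expR_ge1Dx (- x); lra. Qed.

Lemma expR_sub1_le (x : R) : expR x - 1 <= x * expR x.
Proof.
have := one_sub_expRN_le x; rewrite -(ler_pM2r (expR_gt0 x)).
by rewrite mulrBl mul1r -expRD addNr expR0.
Qed.

(** The tangent of the convex function [x^(N+1)] at [q] lies below it; the induction step leaves the
    remainder [(N+1) q^N (r - q)^2]. *)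
Lemma bernoulli_tangent (N : nat) (r q : R) : 0 <= r -> 0 <= q ->
  q ^+ N.+1 + N.+1%:R * q ^+ N * (r - q) <= r ^+ N.+1.
Proof.
move=> r0 q0; elim: N => [|N IH]; first by rewrite !expr1 expr0; lra.
rewrite (exprS r); apply: le_trans (ler_wpM2l r0 IH).
rewrite -subr_ge0 [leRHS](_ : _ = N.+1%:R * q ^+ N * (r - q) ^+ 2).
  by rewrite mulr_ge0 ?sqr_ge0 // mulr_ge0 // exprn_ge0.
by rewrite -[N.+2%:R]natr1 !(exprS q); ring.
Qed.

(* If [r] is the infimum of the growth factors over one step, iterating the
   bound over [N] steps gives [r >= 1 + c r^N], and [q] is the smaller root of
   the corresponding equation. *)
Lemma delay_step_growth H (N : nat) (d q c : R) : 0 < d -> d * N.+1%:R = 1 ->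
    1 < q -> N.+1%:R * (q - 1) <= q -> (q - 1) / q ^+ N.+1 < c ->
    (forall t, 0 < H t) ->
    (forall t, c * H (t + 1) <= H (t + d) - H t) ->
  forall t, q * H t <= H (t + d).
Proof.
move=> d0 dN q1 Nq cq H0 Hd.
have q0 : 0 < q by lra.
have c0 : 0 < c.
  by apply: lt_trans cq; rewrite divr_gt0 ?exprn_gt0 // subr_gt0.
pose E := [set x : R | exists t, x = H (t + d) / H t].
have Elb : lbound E 1.
  move=> _ [t ->]; rewrite ler_pdivlMr // mul1r -subr_ge0.
  by apply: le_trans (Hd t); rewrite mulr_ge0 // ltW.
have E0 : E !=set0 by exists (H (0 + d) / H 0), 0.
have hE : has_inf E by split => //; exists 1.
set r := inf E.
have r1 : 1 <= r by apply: lb_le_inf.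
have rP t : r * H t <= H (t + d).
  by rewrite -ler_pdivlMr //; apply: ge_inf; [exists 1|exists t].
have rN k t : r ^+ k * H t <= H (t + d * k%:R).
  elim: k => [|k IH]; first by rewrite expr0 mul1r mulr0 addr0.
  rewrite exprS -mulrA -natr1 mulrDr mulr1 addrA.
  apply: le_trans (rP _); rewrite ler_pM2l //; lra.
have rr : 1 + c * r ^+ N.+1 <= r.
  apply: lb_le_inf => // _ [t ->]; rewrite ler_pdivlMr //.
  have := Hd t; have := rN N.+1 t; rewrite dN => h1 h2.
  have : c * (r ^+ N.+1 * H t) <= c * H (t + 1) by rewrite ler_pM2l.
  rewrite mulrDl mul1r -mulrA; lra.
(* The curve [1 + (q - 1) / q^(N+1) * x^(N+1)] meets the diagonal at [q] with slope
   [(N+1) (q - 1) / q <= 1], so by convexity it is on or above the diagonal for [0 <= x < q]. As [c]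
   exceeds its coefficient, [r < q] would contradict [rr]. *)
have qr : q <= r.
  rewrite leNgt; apply/negP => rq.
  have r0 : 0 <= r by lra.
  have := bernoulli_tangent N r0 (ltW q0) => hB.
  have h1 : (q - 1) / q ^+ N.+1 * r ^+ N.+1 < c * r ^+ N.+1.
    by rewrite ltr_pM2r // exprn_gt0 //; lra.
  have h2 : (q - 1) / q ^+ N.+1 * (q ^+ N.+1 + N.+1%:R * q ^+ N * (r - q))
       <= (q - 1) / q ^+ N.+1 * r ^+ N.+1.
    by rewrite ler_wpM2l // divr_ge0 ?exprn_ge0 //; lra.
  have h3 : (q - 1) / q ^+ N.+1 * (q ^+ N.+1 + N.+1%:R * q ^+ N * (r - q))
      = (q - 1) + (N.+1%:R * (q - 1) / q) * (r - q).
    by rewrite exprS; field; rewrite ?expf_neq0 ?gt_eqF.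
  have h4 : N.+1%:R * (q - 1) / q <= 1 by rewrite ler_pdivrMr // mul1r.
  have h5 : 1 * (r - q) <= (N.+1%:R * (q - 1) / q) * (r - q).
    by rewrite ler_nM2r //; lra.
  lra.
by move=> t; apply: le_trans (rP t); rewrite ler_pM2r.
Qed.


Lemma telescope_sum_ord (g : nat -> R) n :
  \sum_(j < n) (g j.+1 - g j) = g n - g 0%N.
Proof. by rewrite -(big_mkord xpredT (fun j => g j.+1 - g j)) telescope_sumr. Qed.

(* The potential [I t = u t - (1 - 1/q) (u t + u (t + d) + ... + u (t + 1 - d))],
   where [u t = e^(- s t) H t], is the discrete analogue of the invariant
   [u t - s (integral of u over [t, t + 1])] of [H' t = (s / e^s) H (t + 1)];
   it is nondecreasing along the steps and nonnegative near [- oo]. *)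
Lemma delay_abel_bound H (N : nat) s (d q c kappa : R) :
    0 < s <= 1 -> d * N.+1%:R = 1 -> q = expR (s * d) -> 0 < kappa ->
    (q - 1) * expR (- s) + d * kappa <= c ->
    (forall t, 0 < H t) ->
    (forall t, c * H (t + 1) <= H (t + d) - H t) ->
  kappa * H 0 +
    \sum_(j < N.+1) expR (- s * (d * j.+1%:R)) * (H (d * j.+1%:R) - H (d * j%:R))
  <= expR (- s) * H 1.
Proof.
move=> /andP[s0 s1] dN qE k0 ck H0 Hd.
have d0 : 0 < d by rewrite -(@pmulr_lgt0 _ N.+1%:R) // dN.
have q1 : 1 < q by rewrite qE expR_gt1 mulr_gt0.
have q0 : 0 < q by lra.
have dk : 0 < d * kappa by rewrite mulr_gt0.
have qN : q ^+ N.+1 = expR s by rewrite qE -expRM_natr -mulrA dN mulr1.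
have qV : q^-1 = expR (- (s * d)) by rewrite qE expRN.
have qVs : 1 - q^-1 <= s * d by rewrite qV one_sub_expRN_le.
have qV0 : 0 < 1 - q^-1 by rewrite subr_gt0 invf_lt1.
have Nq : N.+1%:R * (1 - q^-1) <= 1.
  apply: (@le_trans _ _ (N.+1%:R * (s * d))); first by rewrite ler_wpM2l.
  by rewrite mulrCA (mulrC _ d) dN mulr1.
have growth : forall t, q * H t <= H (t + d).
  apply: (@delay_step_growth H N d q c) => //.
  - by rewrite -[leRHS]mul1r -ler_pdivrMr // -mulrA mulrBl mul1r divff ?gt_eqF.
  - by rewrite qN -expRN; lra.
pose u t := expR (- s * t) * H t.
have u0 t : 0 < u t by rewrite mulr_gt0 ?expR_gt0.
have eD t : expR (- s * (t + d)) = expR (- s * t) * q^-1.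
  by rewrite qV -expRD; congr expR; ring.
have umono t : u t <= u (t + d).
  rewrite /u eD -mulrA ler_pM2l ?expR_gt0 // ler_pdivlMl //; exact: growth.
have uN n t : u t <= u (t + d * n%:R).
  elim: n => [|n IH]; first by rewrite mulr0 addr0.
  by rewrite -natr1 mulrDr mulr1 addrA; exact: le_trans IH (umono _).
pose I t := u t - (1 - q^-1) * \sum_(j < N.+1) u (t + d * j%:R).
have Istep t : I (t + d) - I t =
    expR (- s * (t + d)) * (H (t + d) - H t - (q - 1) * expR (- s) * H (t + 1)).
  have := telescope_sum_ord (fun j => u (t + d * j%:R)) N.+1.
  rewrite sumrB dN mulr0 addr0 => tel.
  have sh : \sum_(j < N.+1) u (t + d + d * j%:R)
          = \sum_(j < N.+1) u (t + d * j.+1%:R).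
    by apply: eq_bigr => j _; congr u; rewrite -natr1; ring.
  have u1 : u (t + 1) = expR (- s * t) * expR (- s) * H (t + 1).
    by rewrite /u mulrDr mulr1 expRD.
  rewrite /I sh [X in _ - _ * X - _](_ : _ =
    \sum_(i < N.+1) u (t + d * i%:R) + (u (t + 1) - u t)); last lra.
  rewrite u1 /u eD; field; exact: lt0r_neq0.
have Igap t : expR (- s * (t + d)) * (d * kappa * H (t + 1)) <= I (t + d) - I t.
  rewrite Istep ler_pM2l ?expR_gt0 //; have := Hd t.
  have : (d * kappa + (q - 1) * expR (- s)) * H (t + 1) <= c * H (t + 1).
    by rewrite ler_pM2r //; lra.
  by rewrite mulrDl; lra.
have Imono t : I t <= I (t + d).
  rewrite -subr_ge0; apply: le_trans (Igap t).
  by rewrite mulr_ge0 ?expR_ge0 // mulr_ge0 // ltW.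
have ImonoN n t : I t <= I (t + d * n%:R).
  elim: n => [|n IH]; first by rewrite mulr0 addr0.
  by rewrite -natr1 mulrDr mulr1 addrA; exact: le_trans IH (Imono _).
(* Once a backward sample of [u] is within [e] of the infimum, all samples in the unit window before
   it are too, and [(1 - 1/q) (N+1) <= 1] gives [I >= - e] there; monotonicity of [I] carries this
   bound to [- 1]. *)
have I1 : 0 <= I (- 1).
  pose E := [set x : R | exists n : nat, x = u (- (d * n%:R))].
  have E0 : E !=set0 by exists (u (- (d * 0%:R))), 0%N.
  have hE : has_inf E by split=> //; exists 0 => _ [n ->]; exact: ltW.
  apply/ler_addgt0Pl => e e0.
  have [_ [n ->] ne] := inf_adherent e0 hE.
  set t := - (d * (n + N.+1)%:R).
  have tE : t = - 1 - d * n%:R by rewrite /t natrD mulrDr dN; ring.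
  have le1 : inf E <= u t by apply: ge_inf; [case: hE|exists (n + N.+1)%N].
  have le2 : \sum_(j < N.+1) u (t + d * j%:R) <= u (- (d * n%:R)) * N.+1%:R.
    rewrite -[X in _ <= _ * X%:R]card_ord mulr_natr -sumr_const.
    apply: ler_sum => j _.
    have /subnKC jE : (j <= N.+1)%N by rewrite ltnW.
    have -> : - (d * n%:R) = t + d * j%:R + d * (N.+1 - j)%:R.
      have := congr1 (fun n => n%:R : R) jE; rewrite natrD => h.
      by rewrite -addrA -mulrDr h dN tE; ring.
    exact: uN.
  have le3 : I t <= I (- 1).
    have -> : - 1 = t + d * n%:R by rewrite tE; ring.
    exact: ImonoN.
  have le4 : (1 - q^-1) * \sum_(j < N.+1) u (t + d * j%:R) <= u (- (d * n%:R)).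
    apply: (@le_trans _ _ ((1 - q^-1) * (u (- (d * n%:R)) * N.+1%:R))).
      by rewrite ler_pM2l.
    by rewrite mulrCA (mulrC _ N.+1%:R) ger_pMr.
  by move: le3; rewrite /I; lra.
have Hmono n : H 0 <= H (d * n%:R).
  elim: n => [|n IH]; first by rewrite mulr0.
  rewrite -natr1 mulrDr mulr1; apply: le_trans IH _.
  by apply: le_trans (growth _); rewrite ler_peMl //; [exact: ltW|lra].
(* On each of the [N+1] steps from [- 1] to [0] the weight [e^(- s (t + d))] is at least [1] and
   [H (t + 1) >= H 0], so [I] gains at least [kappa H 0] in all. *)
have I0 n : (n <= N.+1)%N ->
    I (- 1) + n%:R * (d * kappa * H 0) <= I (- 1 + d * n%:R).
  elim: n => [|n IH] nN; first by rewrite mulr0 mul0r !addr0.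
  have := IH (ltnW nN); have := Igap (- 1 + d * n%:R).
  set t := - 1 + d * n%:R => h1 h2.
  rewrite (_ : - 1 + d * n.+1%:R = t + d); last by rewrite /t -natr1; ring.
  rewrite -[n.+1%:R]natr1 mulrDl mul1r.
  have : d * kappa * H 0 <=
      expR (- s * (t + d)) * (d * kappa * H (t + 1)).
    apply: (@le_trans _ _ (d * kappa * H (t + 1))).
      by rewrite ler_pM2l // /t addrAC addNr add0r Hmono.
    apply: ler_peMl; first by rewrite mulr_ge0 // ltW.
    rewrite -expR0 ler_expR.
    rewrite mulNr oppr_ge0 pmulr_rle0 // /t.
    have : d * n.+1%:R <= d * N.+1%:R by rewrite ler_pM2l // ler_nat.
    rewrite dN -natr1; lra.
  lra.
have := I0 N.+1 (leqnn _); rewrite dN addNr.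
rewrite !mulrA (mulrC _ d) dN mul1r => I0'.
(* Summation by parts: with [x = d j], each term equals [u (x + d) - u x / q]. *)
suff -> : \sum_(j < N.+1)
     expR (- s * (d * j.+1%:R)) * (H (d * j.+1%:R) - H (d * j%:R))
   = expR (- s) * H 1 - I 0 by lra.
have tel := telescope_sum_ord (fun j => u (d * j%:R)) N.+1.
rewrite dN mulr0 in tel.
rewrite /I; under [in RHS]eq_bigr do rewrite add0r.
have -> : expR (- s) * H 1 = u 1 by rewrite /u mulr1.
rewrite opprB addrA addrAC -tel mulr_sumr -big_split /=.
apply: eq_bigr => j _; rewrite /u.
rewrite (_ : d * j.+1%:R = d * j%:R + d); last by rewrite -natr1; ring.
by rewrite eD; ring.
Qed.

Lemma expRN_sub_le s (x y : R) : 0 < s ->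
  (expR (- s * x) - expR (- s * y)) / s <= (y - x) * expR (- s * x).
Proof.
move=> s0; rewrite ler_pdivrMr //.
have -> : expR (- s * y) = expR (- s * x) * expR (- (s * (y - x))).
  by rewrite -expRD; congr expR; ring.
have := one_sub_expRN_le (s * (y - x)); rewrite -(ler_pM2l (expR_gt0 (- s * x))).
lra.
Qed.

(** At [tau] the argument switches from the bound [H' u >= 1] to the exponential one; [tau] is left
    free so that it can later be placed where the two cross. Strictness comes from
    [rho < e^s / s]. *)
Lemma delay_lower_bound H s rho (tau : R) : 0 < s <= 1 ->
    0 < rho < expR s / s -> 0 <= tau <= 1 ->
    (forall t, 0 < H t) ->
    (forall t d, 0 < d -> d / rho * H (t + 1) <= H (t + d) - H t) ->
    (forall t d, 0 <= t -> 0 < d -> d <= H (t + d) - H t) ->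
  (1 - expR (- s * tau)) / s + (1 - tau) * (s * expR (- s) * H 1)
    < expR (- s) * H 1.
Proof.
move=> /andP[s0 s1] /andP[rho0 rhos] /andP[tau0 tau1] H0 Hdelay Hslope.
have es0 := expR_gt0 (- s).
have es1 : expR (- s) <= 1 by rewrite expR_le1; lra.
set K := s * expR (- s) * H 1.
have K0 : 0 < K by rewrite !mulr_gt0.
(* Half the gap between [1 / rho] and its critical value [s e^(- s)]: one half covers the
   discretization error in [cgap], the other yields the gain [kappa H 0]. *)
pose kappa := (rho^-1 - s * expR (- s)) / 2.
have kappa0 : 0 < kappa.
  rewrite /kappa; apply: divr_gt0 => //; rewrite subr_gt0 expRN.
  by rewrite -invf_div ltf_pV2 ?posrE ?divr_gt0 ?expR_gt0.
(* [phi x] integrates over [[0, x]] the lower bound for [e^(- s u) H' u], namely [e^(- s u)] up to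
   [tau] and the constant [K] beyond. *)
pose phi x := (1 - expR (- s * Num.min x tau)) / s + Num.max (x - tau) 0 * K.
have phi_incr x d m : 0 <= d -> expR (- s * x) <= m -> K <= m ->
    phi (x + d) - phi x <= d * m.
  move=> d0 xm Km; rewrite /phi.
  have aux y : x <= y -> (expR (- s * x) - expR (- s * y)) / s <= (y - x) * m.
    move=> xy; apply: le_trans (expRN_sub_le _ _ s0) _.
    by rewrite ler_wpM2l // subr_ge0.
  have auxK z : 0 <= z -> z * K <= z * m by move=> z0; rewrite ler_wpM2l.
  have [xt|tx] : x <= tau \/ tau < x by case: leP; [left|right].
  - rewrite (min_l xt) (max_r (x := x - tau)) ?subr_le0 //.
    have [xdt|txd] : x + d <= tau \/ tau < x + d by case: leP; [left|right].
    + rewrite (min_l xdt) (max_r (y := 0)) ?subr_le0 //.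
      by have := aux (x + d); rewrite lerDl => /(_ d0); lra.
    + have td : 0 <= x + d - tau by lra.
      rewrite (min_r (ltW txd)) (max_l td).
      have h1 := aux tau xt.
      have h2 : (x + d - tau) * K <= (x + d - tau) * m.
        exact: auxK.
      lra.
  - have txd : tau <= x + d by lra.
    have td : 0 <= x + d - tau by lra.
    have td' : 0 <= x - tau by lra.
    rewrite (min_r txd) (min_r (ltW tx)) (max_l td) (max_l td').
    by have := auxK d d0; lra.
have phi1E : phi 1 = (1 - expR (- s * tau)) / s + (1 - tau) * K.
  by rewrite /phi min_r // max_l // subr_ge0.
have phi0E : phi 0 = 0.
  by rewrite /phi min_l // max_r ?sub0r ?oppr_le0 // mulr0 expR0 subrr !mul0r addr0.
have phi1_ge0 : 0 <= phi 1.
  rewrite phi1E addr_ge0 //.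
    apply: divr_ge0; last exact: ltW.
    by rewrite subr_ge0 expR_le1 mulNr oppr_le0 mulr_ge0 // ltW.
  by rewrite mulr_ge0 ?subr_ge0 // ltW.
rewrite -phi1E.
(* The grid sum takes the weight at the right end of each cell, which costs a factor
   [1 / q >= 1 - e]; the loss [phi 1 * e] has to stay below the gain [kappa H 0]. *)
pose e := kappa * H 0 / (phi 1 + 1 + H 0).
have den0 : 0 < phi 1 + 1 + H 0 by have := H0 0; lra.
have kH0 : 0 < kappa * H 0 by rewrite mulr_gt0.
have e0 : 0 < e by rewrite divr_gt0.
have ek : e <= kappa.
  by rewrite /e -mulrA ger_pMr // ler_pdivrMr // mul1r; lra.
have pe : phi 1 * e < kappa * H 0.
  by rewrite /e mulrCA gtr_pMr // ltr_pdivrMr // mul1r; have := H0 0; lra.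
have [N eN] : exists N : nat, expR 1 / e < N.+1%:R.
  exists (Num.bound (expR 1 / e)); apply: lt_trans (archi_boundP _) _.
    by rewrite divr_ge0 ?expR_ge0 // ltW.
  by rewrite ltr_nat.
pose d := (N.+1%:R)^-1 : R.
have d0 : 0 < d by rewrite invr_gt0.
have d1 : d <= 1 by rewrite invf_le1 ?ler1n.
have dN : d * N.+1%:R = 1 by rewrite mulVf.
pose q := expR (s * d).
have q0 : 0 < q := expR_gt0 _.
have q1 : 1 < q by rewrite expR_gt1 mulr_gt0.
have sd1 : s * d <= 1 by rewrite mulr_ile1 // ltW.
have qe : q - 1 <= e.
  apply: le_trans (expR_sub1_le _) _.
  apply: (@le_trans _ _ (d * expR 1)).
    apply: ler_pM; rewrite ?expR_ge0 ?ler_expR //.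
      by rewrite mulr_ge0 // ltW.
    by rewrite ler_piMl // ltW.
  by rewrite mulrC ler_pdivrMr // mulrC -ler_pdivrMr // ltW.
have cgap : (q - 1) * expR (- s) + d * kappa <= d / rho.
  have h1 : q - 1 <= s * d * q := expR_sub1_le _.
  have h2 : (q - 1) * expR (- s) <= s * d * q * expR (- s) by rewrite ler_pM2r.
  have h3 : s * expR (- s) * (q - 1) <= kappa.
    apply: (@le_trans _ _ (q - 1)); last lra.
    apply: ler_piMl; first by rewrite subr_ge0 ltW.
    by rewrite mulr_ile1 // ltW.
  have h4 : d * (s * expR (- s) * (q - 1)) <= d * kappa by rewrite ler_pM2l.
  have -> : d / rho = d * (s * expR (- s)) + 2 * (d * kappa).
    by rewrite /kappa; field; rewrite gt_eqF.
  lra.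
have Hd t : d / rho * H (t + 1) <= H (t + d) - H t by exact: Hdelay.
have s01 : 0 < s <= 1 by rewrite s0.
have := delay_abel_bound s01 dN erefl kappa0 cgap H0 Hd.
have growth : forall t, q * H t <= H (t + d).
  have qN : q ^+ N.+1 = expR s by rewrite -expRM_natr -mulrA dN mulr1.
  apply: (@delay_step_growth H N d q (d / rho)) => //.
  - rewrite -(ler_pM2l d0) mulrA dN mul1r; apply: le_trans (expR_sub1_le _) _.
    by rewrite ler_pM2r // ler_piMl // ltW.
  - rewrite qN -expRN; apply: lt_le_trans cgap.
    by rewrite ltrDl mulr_gt0.
have growthN n : expR (s * (d * n%:R)) * H 1 <= H (d * n%:R + 1).
  elim: n => [|n IH]; first by rewrite !mulr0 expR0 mul1r add0r.
  have -> : d * n.+1%:R + 1 = d * n%:R + 1 + d by rewrite -natr1; ring.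
  apply: le_trans (growth _).
  have -> : expR (s * (d * n.+1%:R)) = q * expR (s * (d * n%:R)).
    by rewrite -expRD; congr expR; rewrite -natr1; ring.
  by rewrite -mulrA ler_pM2l.
suff : phi 1 / q <= \sum_(j < N.+1) expR (- s * (d * j.+1%:R)) *
                     (H (d * j.+1%:R) - H (d * j%:R)).
  have : phi 1 - phi 1 * e <= phi 1 / q.
    have -> : phi 1 - phi 1 * e = phi 1 * (1 - e) by ring.
    rewrite ler_wpM2l // lerBlDr -lerBlDl; apply: le_trans qe.
    by rewrite -(ler_pM2r q0) mulrBl mulVf ?gt_eqF //; nra.
  lra.
have -> : phi 1 / q = \sum_(j < N.+1) (phi (d * j.+1%:R) - phi (d * j%:R)) / q.
  by rewrite -mulr_suml (telescope_sum_ord (fun j => phi (d * j%:R))) dN mulr0 phi0E subr0.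
apply: ler_sum => j _.
set x := d * j%:R.
have xE : d * j.+1%:R = x + d by rewrite /x -natr1; ring.
have x0 : 0 <= x by rewrite mulr_ge0 // ltW.
rewrite xE.
have -> : expR (- s * (x + d)) = expR (- s * x) / q.
  by rewrite /q -expRN -expRD; congr expR; ring.
rewrite mulrAC ler_pM2r ?invr_gt0 //.
set D := H (x + d) - H x.
have D0 : 0 < D by apply: lt_le_trans (Hslope x d x0 d0).
have -> : expR (- s * x) * D = d * (expR (- s * x) * D / d).
  by field; rewrite gt_eqF.
apply: phi_incr; first exact: ltW.
  by rewrite ler_pdivlMr // ler_pM2l ?expR_gt0 // Hslope.
rewrite ler_pdivlMr //.
have := Hdelay x d d0; have := growthN j; rewrite -/x -/D => h1 h2.
have h3 : d * (s * expR (- s)) * H (x + 1) <= d / rho * H (x + 1).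
  rewrite ler_pM2r // ler_pM2l //; move: kappa0; rewrite /kappa; lra.
have h4 : d * (s * expR (- s)) * (expR (s * x) * H 1) <= D.
  apply: le_trans (le_trans h3 h2); rewrite ler_pM2l // !mulr_gt0 //.
move: h4; rewrite -(ler_pM2l (expR_gt0 (- s * x))).
have -> : expR (- s * x) * (d * (s * expR (- s)) * (expR (s * x) * H 1)) =
  (expR (- s * x) * expR (s * x)) * (d * (s * expR (- s)) * H 1) by ring.
rewrite -expRD mulNr addNr expR0 mul1r /K; lra.
Qed.

End DelayInequality.

(** * From expected ranks to the delay inequality by convex conjugation *)

Section BidProfile.
Context {R : realType}.

(* [H] is the convex conjugate of [y |-> y F y - A y]; if the bids are placed
   at [G (n + U)] with [U] uniform on [0, 1], it is the primitive of [G], and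
   [H (F T + 1)] is the expected cost on target [T]. *)
Lemma bid_profile_delay (A F : R -> R) (rho chi : R) : 0 < rho -> F 1 = 0 ->
    (forall y, 0 < y -> 0 <= A y) ->
    (forall y T, 0 < y -> 0 < T -> A y + y * (1 + F T - F y) <= rho * T) ->
    (forall y, 0 < y -> A y + y * (1 - F y) <= chi) ->
    (forall y z, 0 < y -> 0 < z -> A y + y * (F z - F y) <= A z) ->
  exists H : R -> R,
    [/\ forall t, 0 < H t,
        forall t d, 0 < d -> d / rho * H (t + 1) <= H (t + d) - H t,
        forall t d, 0 <= t -> 0 < d -> d <= H (t + d) - H t & H 1 <= chi].
Proof.
move=> rho0 F1 A0 hC hchi hA.
(* The choice [y = 2 rho T] shows that multiplying the target by [2 rho] raises the rank by at least
   [1 / 2]. Hence [F] is unbounded on both sides, which makes [H] finite and positive. *)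
have Fstep T : 0 < T -> F T + 2^-1 <= F (2 * rho * T).
  move=> T0; have y0 : 0 < 2 * rho * T by rewrite !mulr_gt0.
  have h1 := hC _ _ y0 T0; have h2 := A0 _ y0.
  have : 2 * rho * T * (1 + F T - F (2 * rho * T)) <= 2 * rho * T * 2^-1.
    have -> : 2 * rho * T * 2^-1 = rho * T by field.
    lra.
  by rewrite ler_pM2l //; lra.
have r0 : 0 < 2 * rho by rewrite mulr_gt0.
have Fup (n : nat) : n%:R / 2 <= F ((2 * rho) ^+ n).
  elim: n => [|n IH]; first by rewrite expr0 F1 mul0r.
  have := Fstep _ (exprn_gt0 n r0); rewrite -exprS -[n.+1%:R]natr1; lra.
have Fdown (n : nat) : F ((2 * rho) ^- n) <= - (n%:R / 2).
  elim: n => [|n IH]; first by rewrite expr0 invr1 F1 mul0r oppr0.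
  have /Fstep : 0 < (2 * rho) ^- n.+1 by rewrite invr_gt0 exprn_gt0.
  rewrite exprS invfM mulrA divff ?gt_eqF // mul1r -[n.+1%:R]natr1; lra.
have bnd (x : R) : exists n : nat, x <= n%:R.
  exists (Num.bound `|x|); apply: le_trans (ler_norm x) _.
  exact/ltW/archi_boundP.
have Fge t : exists2 T, 0 < T & t <= F T.
  have [n tn] := bnd (2 * t); exists ((2 * rho) ^+ n); first exact: exprn_gt0.
  by apply: le_trans (Fup n); lra.
have Fle t : exists2 T, 0 < T & F T <= t.
  have [n tn] := bnd (- 2 * t); exists ((2 * rho) ^- n).
    by rewrite invr_gt0 exprn_gt0.
  by apply: le_trans (Fdown n) _; lra.
have Fmono y z : 0 < y -> y < z -> F y <= F z.
  move=> y0 yz; have z0 : 0 < z by lra.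
  have h1 := hA _ _ y0 z0; have h2 := hA _ _ z0 y0.
  have : 0 <= (z - y) * (F z - F y) by lra.
  by rewrite pmulr_rge0 ?subr_gt0 // subr_ge0.
pose E t := [set x : R | exists2 y, 0 < y & x = A y + y * (t - F y)].
pose H t := sup (E t).
have E0 t : E t !=set0 by exists (A 1 + 1 * (t - F 1)), 1.
have Eub t T : 0 < T -> t <= F T -> ubound (E (t + 1)) (rho * T).
  move=> T0 tT _ [y y0 ->]; apply: le_trans (hC _ _ y0 T0).
  rewrite lerD2l ler_pM2l //; lra.
have hE t : has_sup (E t).
  split=> //; have [T T0 tT] := Fge (t - 1); exists (rho * T).
  by have := Eub _ _ T0 tT; rewrite subrK.
have HP t y : 0 < y -> A y + y * (t - F y) <= H t.
  by move=> y0; apply: ub_le_sup; [case: (hE t)|exists y].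
(* By [hA], at [t >= F y0] a line of slope [y < y0] does not exceed the line of slope [y0], so only
   slopes at least [y0] matter in the supremum. *)
have Hslope t d y0 : 0 < d -> 0 < y0 -> F y0 <= t -> d * y0 <= H (t + d) - H t.
  move=> d0 y00 Fy0; rewrite lerBrDr addrC -lerBrDr.
  apply: ge_sup => // _ [y yp ->]; rewrite lerBrDr.
  have [yy0|y0y] := ltP y y0.
    apply: le_trans (HP (t + d) _ y00).
    have h1 := hA _ _ yp y00.
    have : 0 <= (y0 - y) * (t - F y0) by rewrite mulr_ge0 ?subr_ge0 // ltW.
    lra.
  apply: le_trans (HP (t + d) _ yp).
  have : d * y0 <= d * y by rewrite ler_pM2l.
  lra.
exists H; split.
- move=> t; have [y y0 Fy] := Fle (t - 1).
  apply: lt_le_trans (HP t _ y0); have := A0 _ y0.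
  have : y * 1 <= y * (t - F y) by rewrite ler_pM2l //; lra.
  lra.
- move=> t d d0.
  (* [sup Y] acts as the bid of rank [t]: targets above it have rank at least [t], whence
     [H (t + 1) <= rho * sup Y], while bids close to it in [Y] give [H] a slope of nearly [sup Y]
     after [t]. *)
  pose Y := [set y : R | 0 < y /\ F y <= t].
  have Y0 : Y !=set0 by have [y y0 Fy] := Fle t; exists y.
  have hY : has_sup Y.
    split=> //; have [T T0 tT] := Fge (t + 1); exists T => y [y0 Fy].
    rewrite leNgt; apply/negP => Ty; have := Fmono _ _ T0 Ty; lra.
  have Hup e : 0 < e -> H (t + 1) <= rho * (sup Y + e).
    move=> e0; have [y [y0 Fy]] := Y0.
    have yY : y <= sup Y by apply: ub_le_sup; [case: hY|].
    have T0 : 0 < sup Y + e by lra.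
    apply: ge_sup => //; apply: Eub => //.
    rewrite leNgt; apply/negP => h.
    have : sup Y + e <= sup Y by apply: ub_le_sup; [case: hY|split=> //; exact: ltW].
    lra.
  apply/ler_addgt0Pr => e e0.
  pose e' := e / (2 * d).
  have e'0 : 0 < e' by rewrite divr_gt0 // mulr_gt0.
  have [y0 [y00 Fy0] yY] := sup_adherent e'0 hY.
  have h1 := Hslope _ _ _ d0 y00 Fy0.
  have h2 : d / rho * H (t + 1) <= d / rho * (rho * (sup Y + e')).
    by rewrite ler_pM2l ?divr_gt0 //; exact: Hup.
  have h3 : d / rho * (rho * (sup Y + e')) = d * (sup Y - e') + e.
    by rewrite /e'; field; rewrite !gt_eqF.
  have h4 : d * (sup Y - e') <= d * y0 by rewrite ler_pM2l // ltW.
  lra.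
- by move=> t d t0 d0; rewrite -[leLHS]mulr1; apply: Hslope => //; rewrite F1.
- by apply: ge_sup => // _ [y y0 ->]; exact: hchi.
Qed.

End BidProfile.

(** * Deterministic strategies: first successful bid and partial sums *)

Section DeterministicStrategy.
Context {R : realType}.
Implicit Types (b : int -> R) (n m : int) (T y : R).

Lemma int_le_nat n m : n <= m -> exists k : nat, m = n + k%:Z.
Proof. by move=> nm; exists `|m - n|%N; lia. Qed.

Lemma strategy_mono b n m : strategy b -> n <= m -> b n <= b m.
Proof.
move=> [_ bS] /int_le_nat[k ->]; elim: k => [|k IH]; first by rewrite addr0.
by apply: le_trans IH _; rewrite -addn1 PoszD addrA ltW.
Qed.

(** Monotone bids reduce minimality to a comparison with the preceding bid, a form that is directly
    measurable in the randomized case. *)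
Lemma is_nstarP b T n : strategy b ->
  is_nstar b T n <-> b (n - 1) < T <= b n.
Proof.
move=> sb; split=> [[Tn nmin]|/andP[nT Tn]].
  rewrite Tn andbT ltNge; apply/negP => /nmin; lia.
split=> // m Tm; rewrite leNgt; apply/negP => mn.
have : b m <= b (n - 1) by apply: strategy_mono => //; lia.
lra.
Qed.

Lemma is_nstar_uniq b T n m : is_nstar b T n -> is_nstar b T m -> n = m.
Proof. by move=> [Tn nP] [Tm mP]; apply/eqP; rewrite eq_le nP // mP. Qed.

Lemma nstarE b T n : is_nstar b T n -> nstar b T = n.
Proof.
by move=> bn; rewrite /nstar; apply: xget_unique => // m /is_nstar_uniq; apply.
Qed.

Lemma nstarP b T : (exists n, is_nstar b T n) -> is_nstar b T (nstar b T).
Proof. exact: xgetPex. Qed.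

Lemma is_nstar_ex b T n m : strategy b -> b m < T <= b n ->
  exists k, is_nstar b T k.
Proof.
move=> sb /andP[mT Tn].
have mn : m <= n.
  by rewrite leNgt; apply/negP => nm; have := strategy_mono sb (ltW nm); lra.
have [k nE] := int_le_nat mn.
have ex : exists j : nat, T <= b (m + j%:Z) by exists k; rewrite -nE.
case: (ex_minnP ex) => j Tj jmin; exists (m + j%:Z); apply/is_nstarP => //.
rewrite Tj andbT; case: j Tj jmin => [|j] Tj jmin; first by rewrite addr0 in Tj; lra.
rewrite ltNge; apply/negP.
have -> : m + j.+1%:Z - 1 = m + j%:Z by lia.
by move=> /jmin; rewrite ltnn.
Qed.

Definition bid_sum b n : \bar R := (\esum_(m in [set m : int | (m <= n)%R]) (b m)%:E)%E.

Lemma bid_sum_ge0 b n : strategy b -> (0 <= bid_sum b n)%E.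
Proof. by move=> [b0 _]; apply: esum_ge0 => m _; rewrite lee_fin ltW. Qed.

Lemma costE b T n : is_nstar b T n -> cost b T = bid_sum b n.
Proof.
move=> bn; rewrite /cost; case: ifPn => [_|/asboolP]; last by case; exists n.
by rewrite (nstarE bn).
Qed.

Lemma cost_fin_num_ex b T : cost b T \is a fin_num ->
  exists n, is_nstar b T n.
Proof. by rewrite /cost; case: ifPn => // /asboolP. Qed.

Lemma cost_ge0 b T : strategy b -> (0 <= cost b T)%E.
Proof.
move=> sb; rewrite /cost; case: ifPn => // _.
exact: (bid_sum_ge0 _ sb).
Qed.

Lemma bid_sum_series b n : strategy b ->
  bid_sum b n = (\sum_(j <oo) (b (n - j%:Z)%R)%:E)%E.
Proof.
move=> [b0 _]; rewrite nneseries_esumT; last by move=> j; rewrite lee_fin ltW.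
rewrite /bid_sum (@reindex_esum _ _ _ [set: nat] _ (fun j : nat => n - j%:Z)) //.
split=> [j _ /=|j k _ _ /=|m /= mn]; [lia|lia|].
by exists `|n - m|%N => //; lia.
Qed.

Lemma bid_sum_recr b n : strategy b ->
  bid_sum b n = (bid_sum b (n - 1) + (b n)%:E)%E.
Proof.
move=> [b0 _]; rewrite /bid_sum (esumID [set m : int | m <= n - 1]); last first.
  by move=> m _; rewrite lee_fin ltW.
congr (_ + _)%E.
  by congr esum; apply/seteqP; split => [m [_ //]|m /= mn]; split=> //=; lia.
rewrite [X in esum X](_ : _ = [set n]) ?esum_set1 ?lee_fin 1?ltW //.
apply/seteqP; split => [m /= [mn /negP]|m /= ->]; first lia.
by split=> //; apply/negP; lia.
Qed.

Lemma bid_sum_mono b n m : strategy b -> n <= m ->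
  (bid_sum b n <= bid_sum b m)%E.
Proof.
move=> sb /int_le_nat[k ->]; elim: k => [|k IH]; first by rewrite addr0.
apply: le_trans IH _; rewrite [leRHS]bid_sum_recr //.
rewrite (_ : n + k.+1%:Z - 1 = n + k%:Z); last by lia.
by rewrite leeDl // lee_fin ltW //; case: sb.
Qed.

Lemma bid_sum_fin_num b n m : strategy b ->
  bid_sum b n \is a fin_num -> bid_sum b m \is a fin_num.
Proof.
move=> sb nfin.
have up k : bid_sum b k \is a fin_num -> bid_sum b (k + 1) \is a fin_num.
  by move=> kfin; rewrite bid_sum_recr // addrK fin_numD kfin.
have down k : bid_sum b k \is a fin_num -> bid_sum b (k - 1) \is a fin_num.
  by rewrite bid_sum_recr // fin_numD => /andP[].
have [/int_le_nat[k ->]|/ltW/int_le_nat[k nE]] := leP n m.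
  elim: k => [|k IH]; first by rewrite addr0.
  by rewrite -addn1 PoszD addrA; exact: up.
have -> : m = n - k%:Z by lia.
elim: k {nE} => [|k IH]; first by rewrite subr0.
have -> : n - k.+1%:Z = n - k%:Z - 1 by lia.
exact: down.
Qed.

(* Bids up to [n - 1] are below [y] and bids from [n] on are at least [y]. *)
Lemma bid_sum_convex b y n m : strategy b -> is_nstar b y n ->
    bid_sum b n \is a fin_num ->
  fine (bid_sum b (n - 1)) + y * (m - n + 1)%:~R <= fine (bid_sum b m).
Proof.
move=> sb /is_nstarP - /(_ sb) /andP[ny yn] nfin.
have fin k : bid_sum b k \is a fin_num := bid_sum_fin_num k sb nfin.
have rec k : fine (bid_sum b k) = fine (bid_sum b (k - 1)) + b k.
  by rewrite {1}bid_sum_recr // fineD.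
have [nm|mn] := leP (n - 1) m.
  have [k ->] := int_le_nat nm; elim: k => [|k IH].
    by rewrite addr0 (_ : n - 1 - n + 1 = 0) ?mulr0 ?addr0 //; lia.
  rewrite [leRHS]rec.
  have -> : n - 1 + k.+1%:Z - 1 = n - 1 + k%:Z by lia.
  have -> : n - 1 + k.+1%:Z - n + 1 = (n - 1 + k%:Z - n + 1) + 1 by lia.
  have : b n <= b (n - 1 + k.+1%:Z) by apply: strategy_mono => //; lia.
  by rewrite intrD mulrDr; lra.
have [k nE] := int_le_nat (ltW mn).
have {mn nE}-> : m = n - 1 - k%:Z by lia.
elim: k => [|k IH].
  by rewrite subr0 (_ : n - 1 - n + 1 = 0) ?mulr0 ?addr0 //; lia.
move: IH; rewrite [fine (bid_sum b (n - 1 - k%:Z))]rec.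
have -> : n - 1 - k%:Z - 1 = n - 1 - k.+1%:Z by lia.
have -> : n - 1 - k%:Z - n + 1 = (n - 1 - k.+1%:Z - n + 1) + 1 by lia.
have : b (n - 1 - k%:Z) <= b (n - 1) by apply: strategy_mono => //; lia.
by rewrite intrD mulrDr; lra.
Qed.

End DeterministicStrategy.

(** * Measurability and expectations for randomized strategies *)

Section RandomizedStrategy.
Context {R : realType} {d : measure_display} {Omega : measurableType d}.
Variable b : Omega -> int -> R.
Hypothesis rb : rand_strategy b.

Let sb w : strategy (b w) := rb.1 w.
Let mb n : measurable_fun setT (fun w => b w n) := rb.2 n.

Lemma measurable_is_nstar (T : R) n : measurable [set w | is_nstar (b w) T n].
Proof.
rewrite (_ : [set _ | _] = (fun w => b w (n - 1)) @^-1` `]-oo, T[ `&`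
                           (fun w => b w n) @^-1` `[T, +oo[); last first.
  apply/seteqP; split=> w /=; rewrite !in_itv /= andbT.
    by move=> /is_nstarP-/(_ (sb w)) /andP[].
  by move=> [h1 h2]; apply/is_nstarP => //; rewrite h1.
by apply: measurableI; rewrite -[X in measurable X]setTI; exact: mb.
Qed.

(** The possible first successful indices are countably many; [pickle] lists them by [nat], and [c]
    covers the outcomes without such an index. *)
Lemma measurable_nstar_cases (T : R) (g : Omega -> \bar R)
    (G : int -> Omega -> \bar R) (c : Omega -> \bar R) :
    (forall n, measurable_fun setT (G n)) -> measurable_fun setT c ->
    (forall w n, is_nstar (b w) T n -> g w = G n w) ->
    (forall w, ~ (exists n, is_nstar (b w) T n) -> g w = c w) ->
  measurable_fun setT g.
Proof.
move=> mG mc gG gc.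
pose D n := [set w | is_nstar (b w) T n].
pose E (k : nat) := if unpickle k is Some n then D n else set0.
have mE k : measurable (E k).
  by rewrite /E; case: unpickle => // n; exact: measurable_is_nstar.
have EU : \bigcup_k E k = [set w | exists n, is_nstar (b w) T n].
  apply/seteqP; split=> [w [k _]|w [n wn]] /=.
    by rewrite /E; case: unpickle => // n wn; exists n.
  by exists (pickle n) => //; rewrite /E pickleK.
have mU : measurable (\bigcup_k E k) by exact: bigcup_measurable.
rewrite -(setvU (\bigcup_k E k)); apply/measurable_funU => //.
  exact: measurableC.
split.
  apply: (@eq_measurable_fun _ _ _ _ _ c).
    by move=> w; rewrite inE /= EU => wn; rewrite gc.
  exact: measurable_funTS.
apply/measurable_fun_bigcup => // k; rewrite /E.
case: unpickle => [n|]; last exact: measurable_fun_set0.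
apply: (@eq_measurable_fun _ _ _ _ _ (G n)).
  by move=> w; rewrite inE /= => wn; rewrite (gG _ _ wn).
exact: measurable_funTS.
Qed.

Lemma measurable_bid_sum n : measurable_fun setT (fun w => bid_sum (b w) n).
Proof.
apply: (eq_measurable_fun (fun w => (\sum_(j <oo | j \in xpredT) (b w (n - j%:Z)%R)%:E)%E)).
  by move=> w _; rewrite bid_sum_series //.
apply: ge0_emeasurable_sum => [k w _ _|k _].
  by rewrite lee_fin ltW //; case: (sb w).
exact/measurable_EFinP/mb.
Qed.

Lemma measurable_cost (T : R) : measurable_fun setT (fun w => cost (b w) T).
Proof.
apply: (@measurable_nstar_cases T _ (fun n w => bid_sum (b w) n) (cst +oo%E)) => //.
- exact: measurable_bid_sum.
- by move=> w n; exact: costE.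
- by move=> w wn; rewrite /cost; case: ifPn => // /asboolP.
Qed.

Lemma measurable_nstar (T : R) :
  measurable_fun setT (fun w => (nstar (b w) T)%:~R : R).
Proof.
apply/measurable_EFinP.
apply: (@measurable_nstar_cases T _ (fun n w => (n%:~R)%:E) (cst 0%E)) => //.
- by move=> w n /nstarE /= ->.
- by move=> w wn /=; rewrite /nstar xgetPN // => n h; apply: wn; exists n.
Qed.

Lemma measurable_bid_sum_before (T : R) :
  measurable_fun setT (fun w => bid_sum (b w) (nstar (b w) T - 1)).
Proof.
apply: (@measurable_nstar_cases T _ (fun n w => bid_sum (b w) (n - 1))
                                   (fun w => bid_sum (b w) (- 1))).
- by move=> n; exact: measurable_bid_sum.
- exact: measurable_bid_sum.
- by move=> w n /nstarE ->.
- move=> w wn; rewrite /nstar xgetPN ?sub0r // => n h.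
  by apply: wn; exists n.
Qed.


(** [A y] is the expected total of the bids below [y], and [F y] the expected index of the first bid
    at least [y], counted from that of target [1]. The inequalities are expectations of
    [bid_sum_convex], with [m] the index reaching [T], or the one before the index reaching [z]. *)
Lemma rand_strategy_profile (P : probability Omega R) (rho chi : R) :
    robust P b rho -> consistent P b chi ->
  exists A F : R -> R,
    [/\ F 1 = 0, forall y, 0 < y -> 0 <= A y,
        forall y T, 0 < y -> 0 < T -> A y + y * (1 + F T - F y) <= rho * T,
        forall y, 0 < y -> A y + y * (1 - F y) <= chi &
        forall y z, 0 < y -> 0 < z -> A y + y * (F z - F y) <= A z].
Proof.
move=> brho bchi.
have cint T : 0 < T -> P.-integrable setT (fun w => cost (b w) T).
  move=> T0; apply/integrableP; split; first exact: measurable_cost.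
  under eq_integral do rewrite gee0_abs ?cost_ge0 //.
  exact: le_lt_trans (brho _ T0) (ltry _).
(* Finiteness at these countably many targets gives every target a first successful bid, so the
   default value of [nstar] never enters on [D]. *)
pose D := [set w | forall k : nat, cost (b w) k.+1%:R \is a fin_num /\
                                   cost (b w) (k.+1%:R^-1) \is a fin_num].
have Dae : {ae P, forall w, D w}.
  apply: ae_foralln => k.
  have h1 := integrable_ae measurableT (cint _ (ltr0Sn R k)).
  have k0 : 0 < k.+1%:R^-1 :> R by rewrite invr_gt0.
  have h2 := integrable_ae measurableT (cint _ k0).
  by apply: filterS2 h1 h2 => w h1 h2; split; [exact: h1|exact: h2].
have mfin T : measurable [set w | cost (b w) T \is a fin_num].
  rewrite (_ : [set _ | _] = setT `&` (fun w => cost (b w) T) @^-1` [set~ +oo%E]).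
    by apply: measurable_cost => //; exact: measurableC.
  apply/seteqP; split=> w /=; first by move=> h; split=> // e; rewrite e in h.
  by move=> [_ h]; rewrite ge0_fin_numE ?cost_ge0 // ltey; apply/eqP.
have mD : measurable D.
  rewrite (_ : D = \bigcap_k ([set w | cost (b w) k.+1%:R \is a fin_num] `&`
                             [set w | cost (b w) (k.+1%:R^-1) \is a fin_num])).
    by apply: bigcapT_measurable => k; exact: measurableI.
  by apply/seteqP; split=> w h k //=; exact: h.
have PD : P D = 1%E.
  have PC0 : P (~` D) = 0%E.
    by apply: measure_negligible; [exact: measurableC|exact: Dae].
  by rewrite -[D]setCK probability_setC ?PC0 ?sube0 //; exact: measurableC.
have bnd (x : R) : 0 < x -> exists k : nat, x <= k.+1%:R.
  move=> x0; exists (Num.bound x); apply: ltW.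
  by apply: lt_trans (archi_boundP (ltW x0)) _; rewrite ltr_nat.
have Dnstar w T : D w -> 0 < T -> is_nstar (b w) T (nstar (b w) T).
  move=> Dw T0; apply: nstarP.
  have [k Tk] := bnd _ T0; have iT0 : 0 < T^-1 by rewrite invr_gt0.
  have [l Tl] := bnd _ iT0.
  have /cost_fin_num_ex[n [kn _]] := (Dw k).1.
  have /cost_fin_num_ex[m /is_nstarP-/(_ (sb w)) /andP[ml _]] := (Dw l).2.
  apply: (@is_nstar_ex _ _ _ n (m - 1)) => //.
  rewrite (le_trans Tk) // andbT; apply: lt_le_trans ml _.
  by rewrite invf_ple ?posrE.
have Dfin w n : D w -> bid_sum (b w) n \is a fin_num.
  move=> Dw; have h := Dnstar w 1 Dw ltr01.
  apply: (@bid_sum_fin_num _ _ (nstar (b w) 1)) => //.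
  by rewrite -(costE h); case: (Dw 0%N).
pose c T w := fine (cost (b w) T).
pose a y w := fine (bid_sum (b w) (nstar (b w) y - 1)).
pose N T w := (nstar (b w) T)%:~R : R.
have key w y T : D w -> 0 < y -> 0 < T ->
    a y w + y * (N T w - N y w + 1) <= c T w.
  move=> Dw y0 T0; rewrite /c (costE (Dnstar w T Dw T0)) /N -intrB -(intrD _ _ 1).
  by apply: bid_sum_convex => //; [exact: Dnstar|exact: Dfin].
have key2 w y z : D w -> 0 < y -> 0 < z -> a y w + y * (N z w - N y w) <= a z w.
  move=> Dw y0 z0.
  have := @bid_sum_convex _ (b w) y (nstar (b w) y) (nstar (b w) z - 1) (sb w)
    (Dnstar _ _ Dw y0) (Dfin _ _ Dw).
  by rewrite addrAC subrK intrB.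
have a0 w y : D w -> 0 <= a y w by move=> Dw; rewrite fine_ge0 // bid_sum_ge0.
have c0 w T : 0 <= c T w by rewrite fine_ge0 // cost_ge0.
have mc T : measurable_fun D (c T).
  apply: measurable_funTS; apply: measurableT_comp => //; exact: measurable_cost.
have ma y : measurable_fun D (a y).
  apply: measurable_funTS; apply: measurableT_comp => //.
  exact: measurable_bid_sum_before.
have mN T : measurable_fun D (N T) by apply: measurable_funTS; exact: measurable_nstar.
have cI T : 0 < T -> P.-integrable D (EFin \o c T).
  move=> T0; apply: (@eq_integrable _ _ _ _ _ mD (fun w => cost (b w) T)).
    move=> w; rewrite inE => Dw /=; rewrite fineK // (costE (Dnstar _ _ Dw T0)).
    exact: Dfin.
  by apply: integrableS (cint _ T0).
have cE T : 0 < T -> ((\int[P]_(w in D) c T w)%:E <= rand_cost P b T)%E.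
  move=> T0; rewrite /Rintegral fineK; last by apply: integrable_fin_num; [|exact: cI].
  apply: (@le_trans _ _ (\int[P]_(w in D) cost (b w) T)%E); last first.
    apply: ge0_subset_integral => //; first exact: measurable_cost.
    by move=> w _; exact: cost_ge0.
  apply: ge0_le_integral => //.
  - by move=> w _; rewrite lee_fin.
  - exact/measurable_EFinP.
  - by apply: measurable_funTS; exact: measurable_cost.
  - by move=> w Dw; rewrite fineK // (costE (Dnstar _ _ Dw T0)) Dfin.
have aI y : 0 < y -> P.-integrable D (EFin \o a y).
  move=> y0; apply: le_integrable (cI _ y0) => //; first exact/measurable_EFinP.
  move=> w Dw /=; rewrite lee_fin !ger0_norm //; last exact: a0.
  by have := key w y y Dw y0 y0; rewrite subrr add0r mulr1; lra.
(* The labelling of the bids may be shifted separately for each outcome, so [N T] need not be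
   integrable; the difference is, being bounded by [c T + c 1 / T]. *)
pose F T w := N T w - N 1 w.
have FI T : 0 < T -> P.-integrable D (EFin \o F T).
  move=> T0.
  pose g w := c T w + T^-1 * c 1 w.
  have gI : P.-integrable D (EFin \o g).
    exact: (integrableD mD (cI _ T0) (integrableZl mD T^-1 (cI _ ltr01))).
  apply: le_integrable gI => //; first by apply/measurable_EFinP/measurable_funB.
  move=> w Dw /=; rewrite lee_fin [leRHS]ger0_norm; last first.
    by rewrite addr_ge0 // mulr_ge0 // invr_ge0 ltW.
  have h1 := key w 1 T Dw ltr01 T0; have h2 := key w T 1 Dw T0 ltr01.
  have a1 := a0 w 1 Dw; have aT := a0 w T Dw; have c1 := c0 w 1; have cT := c0 w T.
  have h3 : N 1 w - N T w <= T^-1 * c 1 w.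
    by rewrite ler_pdivlMl //; lra.
  have h4 : 0 <= T^-1 * c 1 w by rewrite mulr_ge0 // invr_ge0 ltW.
  rewrite ler_norml /F /g; lra.
exists (fun y => \int[P]_(w in D) a y w), (fun y => \int[P]_(w in D) F y w).
have lin y z : 0 < y -> 0 < z ->
    \int[P]_(w in D) a y w +
      y * (\int[P]_(w in D) F z w - \int[P]_(w in D) F y w)
    = \int[P]_(w in D) (a y w + y * (F z w - F y w)) /\
    P.-integrable D (EFin \o (fun w => a y w + y * (F z w - F y w))).
  move=> y0 z0.
  have FBI : P.-integrable D (EFin \o (fun w => F z w - F y w)).
    exact: (integrableB mD (FI _ z0) (FI _ y0)).
  have ZI : P.-integrable D (EFin \o (fun w => y * (F z w - F y w))).
    exact: (integrableZl mD y FBI).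
  rewrite (RintegralD mD (aI _ y0) ZI) (RintegralZl _ mD FBI).
  rewrite (RintegralB mD (FI _ z0) (FI _ y0)).
  split=> //; exact: (integrableD mD (aI _ y0) ZI).
have step y T : 0 < y -> 0 < T ->
  ((\int[P]_(w in D) a y w + y * (1 + \int[P]_(w in D) F T w
     - \int[P]_(w in D) F y w))%:E <= rand_cost P b T)%E.
  move=> y0 T0; apply: le_trans (cE _ T0); rewrite lee_fin.
  have [linE linI] := lin y T y0 T0.
  rewrite -addrA mulrDr mulr1 addrCA linE.
  have yI : P.-integrable D (EFin \o (cst y)).
    by apply: finite_measure_integrable_cst.
  have yE : \int[P]_(w in D) (cst y) w = y by rewrite Rintegral_cst // [X in fine X]PD mulr1.
  rewrite -[X in X + _]yE -(RintegralD mD yI linI).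
  apply: le_Rintegral => //; [|exact: cI|].
    exact: (integrableD mD yI linI).
  by move=> w Dw; have := key w y T Dw y0 T0; rewrite /F /cst; lra.
split.
- by rewrite /F; under eq_Rintegral do rewrite subrr; rewrite Rintegral_cst // mul0r.
- by move=> y y0; apply: Rintegral_ge0 => w; exact: a0.
- by move=> y T y0 T0; rewrite -lee_fin; exact: le_trans (step y T y0 T0) (brho _ T0).
- move=> y y0; rewrite -lee_fin; apply: le_trans bchi.
  have := step y 1 y0 ltr01.
  rewrite [X in 1 + X](_ : _ = 0) ?addr0 //.
  by rewrite /F; under eq_Rintegral do rewrite subrr; rewrite Rintegral_cst // mul0r.
- move=> y z y0 z0; have [-> linI] := lin y z y0 z0.
  apply: le_Rintegral => //; first exact: aI.
  by move=> w Dw; have := key2 w y z Dw y0 z0; rewrite /F; lra.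
Qed.

End RandomizedStrategy.

(** * Optimality of the robustness *)

Section ParetoLowerBound.
Context {R : realType}.
Implicit Types s x y : R.

(** The derivative [1 - ln x] is nonnegative up to [e]; the proof only needs [ln y <= 1] and
    [ln r <= r - 1] for the ratio [r = y / x]. *)
Lemma mul_2Bln_le x y : 1 <= x -> x <= y -> y <= expR 1 ->
  x * (2 - ln x) <= y * (2 - ln y).
Proof.
move=> x1 xy ye; have x0 : 0 < x by lra.
set r := y / x.
have r1 : 1 <= r by rewrite ler_pdivlMr ?mul1r.
have r0 : 0 < r by lra.
have yE : y = x * r by rewrite /r mulrCA divff ?mulr1 // gt_eqF.
have lny : ln y = ln x + ln r by rewrite yE lnM.
have lny1 : ln y <= 1 by rewrite -(@expRK R 1) ler_ln ?posrE ?expR_gt0 //; lra.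
have lnr : ln r <= r - 1.
  by have := expR_ge1Dx (ln r); rewrite lnK ?posrE //; lra.
rewrite -subr_ge0 lny yE.
have -> : x * r * (2 - (ln x + ln r)) - x * (2 - ln x) =
  x * ((r - 1) * (1 - ln y) + ((r - 1) - ln r)) by rewrite lny; ring.
rewrite mulr_ge0 ?(ltW x0) // addr_ge0 ?subr_ge0 //.
by rewrite mulr_ge0 ?subr_ge0.
Qed.

(** With [xi = e^z] the equation reads [e^z (2 - z) = e^s], and the left side goes from [2] to [e]
    on [[0, 1]]. *)
Lemma xi_sP s : ln 2 <= s <= 1 ->
  1 <= xi_s s <= expR 1 /\ xi_s s * (2 - ln (xi_s s)) = expR s.
Proof.
move=> /andP[ls s1].
pose f (z : R) := expR z * (2 - z).
have fc : continuous f.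
  move=> z; apply: cvgM; first exact: continuous_expR.
  by apply: cvgB; [exact: cvg_cst|exact: cvg_id].
have f0 : f 0 = 2 by rewrite /f expR0 mul1r subr0.
have f1 : f 1 = expR 1 by rewrite /f; ring.
have e2 : 2 <= expR s by rewrite -[leLHS]lnK ?posrE // ler_expR.
have se : expR s <= expR 1 by rewrite ler_expR.
have [|z] := @IVT R f 0 1 (expR s) ler01 (continuous_subspaceT fc).
  by rewrite f0 f1 ge_min le_max e2 se orbT.
rewrite in_itv /= => /andP[z0 z1] fz.
apply: (@xgetPex _ 1 [set x : R | 1 <= x <= expR 1 /\ x * (2 - ln x) = expR s]).
exists (expR z); split; last by rewrite expRK.
by rewrite -{1}expR0 !ler_expR z0.
Qed.

(** For [x = s * H 1], the choice [tau = 1] gives [x > e^s - 1], which settles [s < ln 2]. Otherwise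
    the best [tau] gives [x (2 - ln x) > e^s], against [x <= xi_s s] and [mul_2Bln_le]. *)
Lemma no_better_robustness s rho (d : measure_display)
    (Omega : measurableType d) (P : probability Omega R) (b : Omega -> int -> R) :
    0 < s <= 1 -> rho < rho_s s ->
  rand_strategy b -> robust P b rho -> ~ consistent P b (chi_s s).
Proof.
move=> s01 rhos rb brho bchi.
have [A [F [F1 A0 hC hchi hA]]] := rand_strategy_profile rb brho bchi.
have rho0 : 0 < rho.
  have := hC 1 1 ltr01 ltr01; have := A0 1 ltr01; rewrite F1; lra.
have [H [H0 Hdelay Hslope H1]] := bid_profile_delay rho0 F1 A0 hC hchi hA.
have rho0s : 0 < rho < expR s / s by rewrite rho0.
have bound tau tau01 := @delay_lower_bound R H s rho tau s01 rho0s tau01 H0 Hdelay Hslope.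
case/andP: s01 => s0 s1.
pose x := s * H 1.
have es0 := expR_gt0 s.
have H1E : H 1 = x / s by rewrite /x; field; rewrite gt_eqF.
have x0 : 0 < x by rewrite mulr_gt0.
have bound' tau : 0 <= tau <= 1 ->
    expR s - expR s * expR (- s * tau) + s * (1 - tau) * x < x.
  move=> /bound; rewrite expRN H1E -(ltr_pM2r (mulr_gt0 s0 es0)).
  have -> : (expR s)^-1 * (x / s) * (s * expR s) = x.
    by field; rewrite !gt_eqF.
  suff -> : ((1 - expR (- s * tau)) / s + (1 - tau) *
     (s * (expR s)^-1 * (x / s))) * (s * expR s) =
     expR s - expR s * expR (- s * tau) + s * (1 - tau) * x by [].
  by field; rewrite !gt_eqF.
have b1 : expR s - 1 < x.
  have := bound' 1; rewrite lexx ler01 => /(_ isT).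
  by rewrite mulr1 subrr mulr0 mul0r addr0 -expRD subrr expR0.
move: H1; rewrite /chi_s; case: ltP => ls.
  by rewrite H1E ler_pM2r ?invr_gt0 //; lra.
have ls1 : ln 2 <= s <= 1 by rewrite ls.
have [/andP[xi1 xie] xiE] := xi_sP ls1.
rewrite H1E ler_pM2r ?invr_gt0 // => xxi.
have e2 : 2 <= expR s by rewrite -[leLHS]lnK ?posrE // ler_expR.
have lnxi : ln (xi_s s) <= 1.
  by rewrite -(@expRK R 1) ler_ln ?posrE ?expR_gt0 //; lra.
have xes : x <= expR s.
  apply: le_trans xxi _; rewrite -xiE ler_peMr //; lra.
have lnx0 : 0 <= ln x by rewrite ln_ge0; lra.
have lnxs : ln x <= s by rewrite -(expRK s) ler_ln ?posrE.
(* The lower bounds [1] and [x e^(s (u - 1))] on [H' u] cross at [u = 1 - ln x / s], which is in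
   [[0, 1]] because [1 <= x <= e^s]. *)
have /bound' : 0 <= 1 - ln x / s <= 1.
  by rewrite subr_ge0 ler_pdivrMr // mul1r lnxs /= gerBl divr_ge0 // ltW.
have -> : - s * (1 - ln x / s) = ln x - s by field; rewrite gt_eqF.
have -> : expR s * expR (ln x - s) = x.
  by rewrite -expRD addrC subrK lnK.
have -> : s * (1 - (1 - ln x / s)) = ln x by field; rewrite gt_eqF.
have := @mul_2Bln_le x (xi_s s) _ xxi xie; rewrite xiE.
have x1 : 1 <= x by lra.
by move=> /(_ x1); lra.
Qed.

End ParetoLowerBound.

(** * Primitives and rules of differentiation on the line *)

Section Primitives.
Context {R : realType}.
Implicit Types (f F : R -> R) (a b x : R).

Lemma is_derive_continuous f F : (forall x, is_derive x 1 F (f x)) -> continuous F.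
Proof.
by move=> Ff x; apply/differentiable_continuous/derivable1_diffP; case: (Ff x).
Qed.

Lemma is_derive_mvt f F a b : a < b ->
    (forall x, a <= x <= b -> is_derive x 1 F (f x)) ->
  exists2 c, a < c < b & F b - F a = f c * (b - a).
Proof.
move=> ab Ff; have [| |c] := @MVT R F f a b ab.
- by move=> x; rewrite in_itv /= => /andP[ax xb]; apply: Ff; rewrite !ltW.
- apply: derivable_within_continuous => x; rewrite in_itv /= => /Ff xab.
  exact: ex_derive.
- by rewrite in_itv /= => cab ->; exists c.
Qed.

Lemma is_derive_lt f F a b : a < b ->
    (forall x, is_derive x 1 F (f x)) ->
    (forall x, a < x < b -> 0 < f x) -> F a < F b.
Proof.
move=> ab Ff f0; have [c cab E] := is_derive_mvt ab (fun x _ => Ff x).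
by rewrite -subr_gt0 E mulr_gt0 ?f0 // subr_gt0.
Qed.

Lemma is_derive_eq0 F a b :
    (forall x, Num.min a b <= x <= Num.max a b -> is_derive x 1 F 0) -> F a = F b.
Proof.
wlog ab : a b / a < b.
  move=> wl Ff; have [ab|[ba|->//]] : a < b \/ (b < a \/ a = b).
      by case: ltgtP; [left|right; left|right; right].
    exact: wl.
  by apply/esym; apply: wl => // x; rewrite minC maxC; exact: Ff.
rewrite (min_l (ltW ab)) (max_r (ltW ab)) => Ff.
have [c _] := is_derive_mvt ab Ff; rewrite mul0r.
by move/eqP; rewrite subr_eq0 => /eqP.
Qed.

(** The integral from [- n] is a primitive only to the right of [- n]; normalized to vanish at [0],
    these primitives agree where both are valid and glue together on the whole line. *)
Lemma continuous_primitive f : continuous f ->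
  exists F, forall x, is_derive x 1 F (f x).
Proof.
move=> cf.
pose P (n : nat) x := (\int[@lebesgue_measure R]_(t in `[- n%:R, x]) f t)%R.
have dP n x : - n%:R < x -> is_derive x 1 (P n) (f x).
  move=> nx.
  have x1 : x < x + 1 by rewrite ltrDl.
  have fI : (@lebesgue_measure R).-integrable `[- n%:R, x + 1] (EFin \o f).
    apply: continuous_compact_integrable; first exact: segment_compact.
    exact: continuous_subspaceT.
  have [h1 h2] := continuous_FTC1_closed x1 fI nx (cf x).
  by apply: DeriveDef; [exact: h1|rewrite -derive1E h2].
pose Q n x := P n x - P n 0.
have dQ n x : - n%:R < x -> is_derive x 1 (Q n) (f x).
  move=> /dP h; rewrite -[f x]subr0.
  by apply: is_deriveB.
have QE (n m : nat) x : (0 < n)%N -> (0 < m)%N -> - n%:R < x -> - m%:R < x ->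
    Q n x = Q m x.
  move=> n0 m0 nx mx; pose D := fun y => Q n y - Q m y.
  suff : D x = D 0 by rewrite /D /Q !subrr => /eqP; rewrite subr_eq0 => /eqP.
  apply: is_derive_eq0 => y /andP[xy _].
  rewrite -(subrr (f y)).
  have n0' : - n%:R < 0 :> R by rewrite oppr_lt0 ltr0n.
  have m0' : - m%:R < 0 :> R by rewrite oppr_lt0 ltr0n.
  by apply: is_deriveB; apply: dQ; apply: lt_le_trans xy; rewrite lt_min ?nx ?mx.
pose k x := (Num.bound `|x|).+1.
have kP x : - (k x)%:R < x.
  rewrite ltrNl; apply: le_lt_trans (ler_norm _) _; rewrite normrN.
  by apply: lt_trans (archi_boundP (normr_ge0 _)) _; rewrite ltr_nat.
exists (fun x => Q (k x) x) => x.
(* [k y] varies with [y], so near [x] the glued function is compared with one fixed primitive; the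
   extra unit in its index makes it valid at distance less than [1] from [x]. *)
have kx : - (k x).+1%:R < x by apply: lt_trans (kP x); rewrite ltrN2 ltr_nat.
have := dQ _ _ kx; apply: near_eq_is_derive => //.
near=> y; apply: QE => //.
near: y; exists 1 => //= y /=; rewrite ltr_norml => /andP[_ xy].
by have := kP x; rewrite -natr1; lra.
Unshelve. all: by end_near. Qed.


Lemma is_derive_addf F g (a b x : R) : is_derive x 1 F a -> is_derive x 1 g b ->
  is_derive x 1 (fun y => F y + g y) (a + b).
Proof. by move=> dF dg; apply: is_deriveD. Qed.

Lemma is_derive_subf F g (a b x : R) : is_derive x 1 F a -> is_derive x 1 g b ->
  is_derive x 1 (fun y => F y - g y) (a - b).
Proof. by move=> dF dg; apply: is_deriveB. Qed.

Lemma is_derive_mulf F g (a b x : R) : is_derive x 1 F a -> is_derive x 1 g b ->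
  is_derive x 1 (fun y => F y * g y) (a * g x + F x * b).
Proof.
move=> dF dg; apply: (is_derive_eq (is_deriveM _ _)).
by rewrite /GRing.scale /= addrC (mulrC a).
Qed.

Lemma is_derive_scalef F (k a x : R) : is_derive x 1 F a ->
  is_derive x 1 (fun y => k * F y) (k * a).
Proof. by move=> dF; apply: is_deriveZ. Qed.

Lemma is_derive_constf (k x : R) : is_derive x 1 (fun=> k) 0.
Proof. exact: is_derive_cst. Qed.

Lemma is_derive_comp_shift F (a c x : R) : is_derive (c + x) 1 F a ->
  is_derive x 1 (fun y => F (c + y)) a.
Proof.
have h : is_derive x 1 (fun y => c + y) (0 + 1).
  by apply: is_derive_addf.
move=> dF; apply: (is_derive_eq (is_derive1_comp dF h)).
by rewrite add0r mulr1.
Qed.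

Lemma is_derive_expRM (k x : R) :
  is_derive x 1 (fun y => expR (k * y)) (k * expR (k * x)).
Proof.
have h : is_derive x 1 (fun y => k * y) (k * 1).
  by apply: is_derive_scalef.
apply: (is_derive_eq (is_derive1_comp (is_derive_expR _) h)).
by rewrite mulr1 mulrC.
Qed.

End Primitives.

(** * Backward solution of the delay equation *)

Section DelayEquation.
Context {R : realType}.
Variable s : R.
Hypothesis s0 : 0 < s.
Implicit Types x : R.

(* A solution [H] of [H' t = (s / e^s) H (t + 1)] is encoded by its pieces
   [f k x = H (x - k)] for [0 <= x <= 1]. The condition [f 0 = s * P 1] says that
   the invariant [H t - s (integral of e^(s (t - u)) H u over [t, t + 1])]
   vanishes, which is what keeps the pieces positive. *)
Definition delay_piece (f P : R -> R) : Prop :=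
  [/\ continuous f, forall x, 0 <= x <= 1 -> 0 < f x,
      forall x, is_derive x 1 P (expR (- s * x) * f x), P 0 = 0 & f 0 = s * P 1].

(** [g] is the primitive of [s e^(- s) f] with [g 1 = f 0]. Integration by parts and [f 0 = s * P 1]
    turn it into a sum of two terms that are visibly nonnegative on [[0, 1]], since [M] increases
    and [P >= 0] there. *)
Lemma delay_piece_step (f P : R -> R) : delay_piece f P ->
  exists g Q, [/\ delay_piece g Q,
    forall x, is_derive x 1 g (s * expR (- s) * f x) & g 1 = f 0].
Proof.
move=> [cf f0 dP P0 fP].
have Ppos x : 0 < x <= 1 -> 0 < P x.
  move=> /andP[x0 x1]; rewrite -P0; apply: is_derive_lt x0 dP _ => y /andP[y0 yx].
  by rewrite mulr_gt0 ?expR_gt0 // f0 // ltW //=; lra.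
have cM : continuous (fun x => expR (s * x) * P x).
  move=> x; apply: cvgM.
    exact: (is_derive_continuous (is_derive_expRM s)).
  exact: (is_derive_continuous dP).
have [M dM] := continuous_primitive cM.
have Mlt x : 0 <= x < 1 -> M x < M 1.
  move=> /andP[x0 x1]; apply: is_derive_lt x1 dM _ => y /andP[xy y1].
  by rewrite mulr_gt0 ?expR_gt0 // Ppos // ltW //; lra.
(* [e^(- s) (W 0 - W x)] is the primitive of [e^(- s x) g x] vanishing at [0], and [W 1 = 0] gives
   the invariant condition for the new piece. *)
pose W x := s * (expR (- s * x) * (M 1 - M x)).
pose g x := s * expR (- s) * (s * (M 1 - M x) + expR (s * x) * P x).
have exK x : expR (s * x) * expR (- s * x) = 1.
  by rewrite -expRD mulNr subrr expR0.
have dg x : is_derive x 1 g (s * expR (- s) * f x).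
  have h1 := is_derive_scalef s (is_derive_subf (is_derive_constf (M 1) x) (dM x)).
  have h2 := is_derive_mulf (is_derive_expRM s x) (dP x).
  apply: (is_derive_eq (is_derive_scalef (s * expR (- s)) (is_derive_addf h1 h2))).
  by rewrite mulrA exK; ring.
have dW x : is_derive x 1 W (- s * (W x + P x)).
  have h1 := is_derive_subf (is_derive_constf (M 1) x) (dM x).
  have h2 := is_derive_mulf (is_derive_expRM (- s) x) h1.
  apply: (is_derive_eq (is_derive_scalef s h2)).
  have : expR (- s * x) * (expR (s * x) * P x) = P x.
    by rewrite mulrA (mulrC (expR _)) exK mul1r.
  by rewrite sub0r mulrN => ->; rewrite /W; ring.
exists g, (fun x => expR (- s) * (W 0 - W x)); split => //; last first.
  rewrite /g subrr mulr0 add0r mulr1 fP mulrA -(mulrA s) -expRD addNr expR0 mulr1 //.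
split.
- exact: is_derive_continuous dg.
- move=> x /andP[x0 x1]; rewrite mulr_gt0 ?mulr_gt0 ?expR_gt0 //.
  have [x1'|x1'] := ltP x 1.
    apply: ltr_pwDl; first by rewrite mulr_gt0 // subr_gt0 Mlt // x0.
    rewrite mulr_ge0 ?expR_ge0 //.
    move: x0; rewrite le_eqVlt => /predU1P[<-|x0]; first by rewrite P0.
    by rewrite ltW // Ppos // x0.
  have -> : x = 1 by lra.
  by rewrite subrr mulr0 add0r mulr_gt0 ?expR_gt0 // Ppos // ltr01 lexx.
- move=> x.
  have h1 := is_derive_subf (is_derive_constf (W 0) x) (dW x).
  apply: (is_derive_eq (is_derive_scalef (expR (- s)) h1)).
  rewrite /g /W; have -> : P x = expR (s * x) * expR (- s * x) * P x.
    by rewrite exK mul1r.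
  by rewrite !mulrA exK; ring: (exK x).
- by rewrite subrr mulr0.
- by rewrite /g /W P0 !mulr0 !expR0 subrr !mulr0 subr0; ring.
Qed.

Lemma delay_pieces (f0 P0 : R -> R) : delay_piece f0 P0 ->
  exists f : nat -> R -> R, f 0%N = f0 /\
    forall k, [/\ continuous (f k), forall x, 0 <= x <= 1 -> 0 < f k x,
      forall x, is_derive x 1 (f k.+1) (s * expR (- s) * f k x) &
      f k.+1 1 = f k 0].
Proof.
move=> f0P0.
pose T := {fP : (R -> R) * (R -> R) | delay_piece fP.1 fP.2}.
have step (t : T) : {t' : T |
    (forall x, is_derive x 1 (sval t').1 (s * expR (- s) * (sval t).1 x)) /\
    (sval t').1 1 = (sval t).1 0}.
  apply: cid; case: t => -[f P] /= /delay_piece_step[g [Q [gQ dg g1]]].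
  by exists (exist _ (g, Q) gQ).
pose u := fix u k : T :=
  if k is k'.+1 then sval (step (u k')) else exist _ (f0, P0) f0P0.
exists (fun k => (sval (u k)).1); split=> // k.
have [cf fpos _ _ _] := svalP (u k).
have [dS S1] := svalP (step (u k)).
by split.
Qed.

End DelayEquation.

(** * The initial piece and the choice of [tau] *)

Section InitialPiece.
Context {R : realType}.
Implicit Types s tau x : R.

(** This is [max 1 (e^(s (x - tau)))], the extremal bid of rank [x >= 0], with the maximum moved
    into the exponent. *)
Definition late_bid s tau x : R := expR (Num.max 0 (s * (x - tau))).

Lemma late_bid_continuous s tau : continuous (late_bid s tau).
Proof.
move=> x; apply: (@continuous_comp _ _ _ (fun y => Num.max 0 (s * (y - tau))) expR).
  apply: (@continuous_max _ _ (fun=> 0) (fun y => s * (y - tau))).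
    exact: cvg_cst.
  apply: cvgMr; apply: cvgB; [exact: cvg_id|exact: cvg_cst].
exact: continuous_expR.
Qed.

Lemma late_bid_left s tau x : 0 < s -> x <= tau -> late_bid s tau x = 1.
Proof.
by move=> s0 xt; rewrite /late_bid max_l ?expR0 // pmulr_rle0 // subr_le0.
Qed.

Lemma late_bid_right s tau x : 0 < s -> tau <= x ->
  late_bid s tau x = expR (s * (x - tau)).
Proof.
by move=> s0 tx; rewrite /late_bid max_r // pmulr_rge0 // subr_ge0.
Qed.

Lemma late_bid_ge1 s tau x : 1 <= late_bid s tau x.
Proof. by rewrite -expR0 ler_expR le_max lexx. Qed.

(** [balance] equates the integral of [e^(- s x) f' x] over [[0, 1]] with [e^(- s) X], which after
    integration by parts is the vanishing invariant [f 0 = s * P 1]. The positive quantity in the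
    next hypothesis is [f 0]. *)
Lemma initial_piece s tau (X : R) : 0 < s -> 0 <= tau <= 1 ->
    (1 - expR (- s * tau)) / s + (1 - tau) * expR (- s * tau) = expR (- s) * X ->
    0 < X - expR (s * (1 - tau)) / s + s^-1 - tau ->
  exists f P, [/\ delay_piece s f P,
    forall x, is_derive x 1 f (late_bid s tau x), f 1 = X &
    forall x, tau <= x -> f x = X + (expR (s * (x - tau)) - expR (s * (1 - tau))) / s].
Proof.
move=> s0 /andP[t0 t1] balance pos.
have [F dF] := continuous_primitive (@late_bid_continuous s tau).
pose f x := F x - (F 1 - X).
have df x : is_derive x 1 f (late_bid s tau x).
  apply: (is_derive_eq (is_derive_subf (dF x) (is_derive_constf (F 1 - X) x))).
  by rewrite subr0.
have cf : continuous f := is_derive_continuous df.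
have f1 : f 1 = X by rewrite /f; ring.
have fright x : tau <= x ->
    f x = X + (expR (s * (x - tau)) - expR (s * (1 - tau))) / s.
  move=> tx; rewrite -f1.
  pose D := fun y => f y - expR (- s * tau) / s * expR (s * y).
  have De y : D y = f y - expR (s * (y - tau)) / s.
    rewrite /D; congr (_ - _); rewrite mulrAC -expRD; congr (expR _ / s); ring.
  have : D x = D 1.
    apply: is_derive_eq0 => y /andP[+ _]; rewrite ge_min => xy.
    have ty : tau <= y by case/orP: xy => h; lra.
    apply: (is_derive_eq (is_derive_subf (df y) (is_derive_scalef _ (is_derive_expRM s y)))).
    rewrite late_bid_right // (_ : s * (y - tau) = - s * tau + s * y); last ring.
    by rewrite expRD; field; rewrite gt_eqF.
  rewrite !De mulrBl; lra.
have fleft x : x <= tau -> f x = f tau - (tau - x).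
  move=> xt; suff : f x - x = f tau - tau by lra.
  apply: (@is_derive_eq0 _ (fun y => f y - y)) => y /andP[_]; rewrite le_max => xy.
  have ty : y <= tau by case/orP: xy => h; lra.
  apply: (is_derive_eq (is_derive_subf (df y) (is_derive_id y 1))).
  by rewrite late_bid_left // subrr.
have ftau : f tau = X - expR (s * (1 - tau)) / s + s^-1.
  by rewrite fright // subrr mulr0 expR0; field; rewrite gt_eqF.
have f0 : 0 < f 0 by rewrite fleft // ftau subr0.
have cP : continuous (fun x => expR (- s * x) * f x).
  move=> x; apply: cvgM; last exact: cf.
  exact: (is_derive_continuous (is_derive_expRM (- s))).
have [P' dP'] := continuous_primitive cP.
pose P x := P' x - P' 0.
have dP x : is_derive x 1 P (expR (- s * x) * f x).
  by apply: (is_derive_eq (is_derive_subf (dP' x) (is_derive_constf (P' 0) x))); rewrite subr0.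
exists f, P; split=> //; split=> //.
- move=> x /andP[x0 x1]; move: x0; rewrite le_eqVlt => /predU1P[<-//|x0].
  apply: lt_trans f0 _; apply: (is_derive_lt x0 df) => y _.
  exact: lt_le_trans (late_bid_ge1 _ _ _).
- by rewrite /P subrr.
have dE x : is_derive x 1 (fun y => expR (- s * y) * f y + s * P y)
    (expR (- s * x) * late_bid s tau x).
  have h1 := is_derive_mulf (is_derive_expRM (- s) x) (df x).
  apply: (is_derive_eq (is_derive_addf h1 (is_derive_scalef s (dP x)))); ring.
pose E y := expR (- s * y) * f y + s * P y.
have E1 : E tau - E 0 = (1 - expR (- s * tau)) / s.
  suff : E 0 + s^-1 * expR (- s * 0) = E tau + s^-1 * expR (- s * tau).
    by rewrite mulr0 expR0; lra.
  apply: (@is_derive_eq0 _ (fun y => E y + s^-1 * expR (- s * y))) => y.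
  rewrite (max_r t0) => /andP[_ yt].
  apply: (is_derive_eq (is_derive_addf (dE y) (is_derive_scalef _ (is_derive_expRM (- s) y)))).
  by rewrite late_bid_left //; field; rewrite gt_eqF.
have E2 : E 1 - E tau = (1 - tau) * expR (- s * tau).
  suff : E tau - expR (- s * tau) * tau = E 1 - expR (- s * tau) * 1 by lra.
  apply: (@is_derive_eq0 _ (fun y => E y - expR (- s * tau) * y)) => y.
  rewrite (min_l t1) => /andP[ty _].
  apply: (is_derive_eq (is_derive_subf (dE y) (is_derive_scalef _ (is_derive_id y 1)))).
  rewrite late_bid_right // -expRD (_ : - s * y + s * (y - tau) = - s * tau); last ring.
  by rewrite mulr1 subrr.
have P0 : P 0 = 0 by rewrite /P subrr.
have : E 1 - E 0 = expR (- s) * X by rewrite -balance -E1 -E2; ring.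
by rewrite /E !mulr0 P0 mulr0 expR0 mul1r mulr1 f1; lra.
Qed.

Lemma initial_piece_chi s : 0 < s <= 1 -> exists tau f P,
  [/\ 0 <= tau <= 1, delay_piece s f P,
      forall x, is_derive x 1 f (late_bid s tau x), f 1 = chi_s s &
      forall x, tau <= x -> f x <= expR (s * (x - tau)) / s].
Proof.
move=> /andP[s0 s1]; have es1 := expR_gt1Dx (lt0r_neq0 s0).
have [ls|ls] := ltP s (ln 2).
  have e2 : expR s < 2 by rewrite -[ltRHS]lnK ?posrE // ltr_expR.
  have chiE : chi_s s = (expR s - 1) / s by rewrite /chi_s ls.
  have sV1 : 1 = s / s by rewrite divff // gt_eqF.
  have [| | |f [P [fP df f1 fr]]] := @initial_piece s 1 (chi_s s) s0.
  - by rewrite lexx ler01.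
  - rewrite mulr1 subrr mul0r addr0 chiE mulrA mulrBr -expRD addNr expR0 mulr1 //.
  - rewrite subrr mulr0 expR0 div1r subrK subr_gt0 chiE ltr_pdivlMr // mul1r; lra.
  exists 1, f, P; split=> //; first by rewrite ler01 lexx.
  move=> x x1; rewrite fr // chiE subrr mulr0 expR0 -mulrDl ler_pM2r ?invr_gt0 //.
  by lra.
have ls1 : ln 2 <= s <= 1 by rewrite ls.
have [/andP[xi1 xie] xiE] := xi_sP ls1.
set xi := xi_s s in xi1 xie xiE *.
have xi0 : 0 < xi by lra.
have l0 : 0 <= ln xi by rewrite ln_ge0.
have l1 : ln xi <= 1 by rewrite -(@expRK R 1) ler_ln ?posrE ?expR_gt0.
have xis : xi <= expR s by rewrite -xiE ler_peMr //; lra.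
have ls' : ln xi <= s by rewrite -(expRK s) ler_ln ?posrE ?expR_gt0.
have chiE : chi_s s = xi / s by rewrite /chi_s ltNge ls.
(* This makes the bid of rank [1] equal to [xi], and the balance condition becomes
   [xi (2 - ln xi) = e^s]. *)
pose tau := 1 - ln xi / s.
have t01 : 0 <= tau <= 1.
  by rewrite /tau subr_ge0 ler_pdivrMr // mul1r ls' /= gerBl divr_ge0 // ltW.
have tE : s * (1 - tau) = ln xi by rewrite /tau; field; rewrite gt_eqF.
have eE : expR (s * (1 - tau)) = xi by rewrite tE lnK.
have eE' : expR (- s * tau) = expR (- s) * xi.
  by rewrite -eE -expRD; congr expR; ring.
have [| |f [P [fP df f1 fr]]] := @initial_piece s tau (chi_s s) s0 t01.
- rewrite eE' chiE.
  have -> : 1 - tau = ln xi / s by rewrite /tau; ring.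
  have -> : 1 - expR (- s) * xi = expR (- s) * (expR s - xi).
    by rewrite mulrBr -expRD addNr expR0.
  by rewrite -xiE; field; rewrite gt_eqF.
- rewrite eE chiE subrr add0r /tau.
  have -> : s^-1 - (1 - ln xi / s) = (1 - s + ln xi) / s by field; rewrite gt_eqF.
  (* Positivity is delicate only at [s = 1], where [xi = 1] would give [2 = e]. *)
  rewrite divr_gt0 //; have [s1'|s1'] := ltP s 1; first lra.
  have sE : s = 1 by lra.
  suff : 0 < ln xi by lra.
  rewrite lt_neqAle l0 andbT; apply/eqP => l0'.
  have xiE1 : xi = 1 by rewrite -[LHS]lnK // -l0' expR0.
  by move: xiE es1; rewrite xiE1 ln1 sE; lra.
exists tau, f, P; split=> // x tx.
by rewrite fr // chiE eE mulrBl addrC subrK.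
Qed.

End InitialPiece.

(** * Expected cost of a uniformly shifted bid sequence *)

Section UniformShift.
Context {R : realType}.
Variables B Q : int -> R -> R.
Hypothesis dQ : forall n (x : R), is_derive x 1 (Q n) (B n x).
Hypothesis cB : forall n, continuous (B n).
Hypothesis B_ge0 : forall n (x : R), 0 <= x <= 1 -> 0 <= B n x.
Hypothesis Q_ge0 : forall n (x : R), 0 <= x <= 1 -> 0 <= Q n x.
Hypothesis QS : forall n : int, Q (n + 1) 0 = Q n 1.
Hypothesis B_gt0 : forall n (x : R), 0 < x < 1 -> 0 < B n x.
Hypothesis B_lt : forall n (x : R), 0 < x < 1 -> B n x < B (n + 1) x.
Hypothesis B_small : forall T : R, 0 < T ->
  exists n, forall x : R, 0 < x < 1 -> B n x < T.

(* The junk value [1/2] is taken off (0, 1), a null set for the uniform law. *)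
Definition shift_strategy (w : R) (n : int) : R :=
  B n (if 0 < w < 1 then w else 2^-1).

Lemma shift_strategyE (w : R) n : 0 < w < 1 -> shift_strategy w n = B n w.
Proof. by move=> w01; rewrite /shift_strategy w01. Qed.

Lemma shift_strategyP (w : R) : strategy (shift_strategy w).
Proof.
have h : 0 < (if 0 < w < 1 then w else 2^-1) < 1 by case: ifP => // _; lra.
by split=> n; [exact: B_gt0|exact: B_lt].
Qed.

Lemma shift_rand_strategy : rand_strategy shift_strategy.
Proof.
split=> [|n]; first exact: shift_strategyP.
have mB : measurable_fun setT (B n) by exact: continuous_measurable_fun.
apply: (measurableT_comp mB); apply: measurable_fun_ifT => //.
by apply: measurable_and; apply: measurable_fun_ltr.
Qed.

Local Notation mu := (@lebesgue_measure R).

Lemma integral_bid n (v : R) : 0 <= v ->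
  (\int[mu]_(x in `[0%R, v]) (B n x)%:E = (Q n v - Q n 0)%:E)%E.
Proof.
rewrite le_eqVlt => /predU1P[<-|v0].
  by rewrite set_itv1 integral_set1 subrr.
have cQ : continuous (Q n) := is_derive_continuous (dQ n).
rewrite (@continuous_FTC2 R (B n) (Q n) 0 v v0) //.
- exact: continuous_subspaceT.
- split.
  + by move=> x _; case: (dQ n x).
  + exact/cvg_at_right_filter/cQ.
  + exact/cvg_at_left_filter/cQ.
- by move=> x _; rewrite derive1E; case: (dQ n x).
Qed.

Lemma shift_cost_le (T v w : R) n : 0 < T -> 0 < w < 1 ->
    (w <= v -> T <= B (n + 1) w) -> (v < w -> T <= B n w) ->
  (cost (shift_strategy w) T <= bid_sum (shift_strategy w) n +
     (if w <= v then B (n + 1) w else 0)%:E)%E.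
Proof.
move=> T0 w01 le_v gt_v.
have sw := shift_strategyP w.
have [m mT] := B_small T0.
have aux k : T <= B k w -> (cost (shift_strategy w) T <= bid_sum (shift_strategy w) k)%E.
  move=> Tk.
  have [] := @is_nstar_ex _ (shift_strategy w) T k m sw.
    by rewrite !shift_strategyE // mT.
  move=> j jT; rewrite (costE jT) bid_sum_mono //.
  by apply: jT.2; rewrite shift_strategyE.
have [wv|wv] := leP w v; last by apply: le_trans (aux _ (gt_v wv)) _; rewrite leeDl.
apply: le_trans (aux _ (le_v wv)) _.
by rewrite bid_sum_recr // addrK shift_strategyE.
Qed.

(** [n + v] acts as the rank of [T]: a shift [w <= v] succeeds by index [n + 1], a larger one by
    index [n]. Bids up to index [n] contribute at most [Q n 1 = Q (n + 1) 0], and the bid of index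
    [n + 1] contributes its integral over [[0, v]]. *)
Lemma shift_rand_cost (T v : R) n : 0 < T -> 0 <= v <= 1 ->
    (forall w, 0 < w < 1 -> w <= v -> T <= B (n + 1) w) ->
    (forall w, 0 < w < 1 -> v < w -> T <= B n w) ->
  (rand_cost (uniform_prob (@ltr01 R)) shift_strategy T <= (Q (n + 1) v)%:E)%E.
Proof.
move=> T0 /andP[v0 v1] le_v gt_v.
have rs := shift_rand_strategy.
have mc := measurable_cost rs T.
rewrite /rand_cost integral_uniform //; last first.
  by move=> w; apply: cost_ge0; exact: shift_strategyP.
rewrite subr0 invr1 mul1e (integral_itv_bndoo _ _); last exact: measurable_funTS.
have mB k : measurable_fun setT (B k) by exact: continuous_measurable_fun.
have mBE k (E : set R) : measurable_fun E (fun w => (B k w)%:E).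
  by apply/measurable_EFinP/measurable_funTS.
have mD : measurable (`]0, 1[%classic : set R) by exact: measurable_itv.
pose g (w : R) := (if w <= v then B (n + 1) w else 0)%:E.
have mg : measurable_fun setT g.
  apply/measurable_EFinP; apply: measurable_fun_ifT => //.
  exact: measurable_fun_ler.
have D01 w : (`]0, 1[%classic : set R) w -> 0 < w < 1 by rewrite /= in_itv.
apply: (@le_trans _ _
    (\int[mu]_(w in `]0%R, 1%R[) (bid_sum (shift_strategy w) n + g w))%E).
  apply: ge0_le_integral => //.
  - by move=> w _; apply: cost_ge0; exact: shift_strategyP.
  - exact: measurable_funTS.
  - apply: measurable_funTS; apply: emeasurable_funD => //.
    exact: measurable_bid_sum.
  - by move=> w /D01 w01; apply: shift_cost_le => //; [exact: le_v|exact: gt_v].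
have g0 w : (`]0, 1[%classic : set R) w -> (0 <= g w)%E.
  move=> /D01 w01; rewrite /g; case: ifP => // _.
  by rewrite lee_fin ltW // B_gt0.
rewrite ge0_integralD //; last 3 first.
- by move=> w _; apply: bid_sum_ge0; exact: shift_strategyP.
- by apply: measurable_funTS; exact: measurable_bid_sum.
- exact: measurable_funTS.
have -> : (Q (n + 1) v)%:E = ((Q n 1)%:E + (Q (n + 1) v - Q (n + 1) 0)%:E)%E.
  by rewrite -EFinD QS; congr EFin; ring.
apply: leeD.
  have -> : (\int[mu]_(w in `]0%R, 1%R[) bid_sum (shift_strategy w) n =
      \int[mu]_(w in `]0%R, 1%R[) \sum_(j <oo) (B (n - j%:Z)%R w)%:E)%E.
    apply: eq_integral => w; rewrite inE => /D01 w01.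
    rewrite bid_sum_series; last exact: shift_strategyP.
    by apply: eq_eseriesr => j _; rewrite shift_strategyE.
  have Bj0 j w : (`]0, 1[%classic : set R) w -> (0 <= (B (n - j%:Z)%R w)%:E)%E.
    by move=> /D01 w01; rewrite lee_fin ltW // B_gt0.
  rewrite integral_nneseries //; last by move=> j; exact: mBE.
  have int_ge0 j : (0 <= \int[mu]_(x in `]0%R, 1%R[) (B (n - j%:Z)%R x)%:E)%E.
    by apply: integral_ge0 => w /D01 w01; rewrite lee_fin ltW // B_gt0.
  apply: lime_le; first by apply: is_cvg_nneseries => j _ _; exact: int_ge0.
  apply: nearW => k.
  apply: (@le_trans _ _ (\sum_(0 <= j < k) (Q (n - j%:Z)%R 1 - Q (n - j%:Z)%R 0)%:E)%E).
    apply: lee_sum => j _; rewrite -integral_bid ?ler01 //.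
    apply: ge0_subset_integral => //.
    - exact: mBE.
    - by move=> x; rewrite /= in_itv /= => x01; rewrite lee_fin B_ge0.
    - exact: subset_itv_oo_cc.
  (* The integrals telescope, and [Q >= 0] lets the lower end be dropped for every number [k] of
     terms. *)
  rewrite sumEFin lee_fin.
  have -> : \sum_(0 <= j < k) (Q (n - j%:Z)%R 1 - Q (n - j%:Z)%R 0) =
      Q n 1 - Q (n - k%:Z) 1.
    elim: k => [|k IH]; first by rewrite big_geq // subr0 subrr.
    rewrite big_nat_recr //= IH -(QS (n - k.+1%:Z)).
    by rewrite (_ : n - k.+1%:Z + 1 = n - k%:Z); [ring|lia].
  by rewrite gerBl Q_ge0 // ler01 lexx.
rewrite -integral_bid //.
apply: (@le_trans _ _ (\int[mu]_(w in `]0%R, 1%R[ `&` [set w | (w <= v)%R])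
    (B (n + 1)%R w)%:E)%E).
  rewrite integral_mkcondr le_eqVlt; apply/orP; left; apply/eqP.
  apply: eq_integral => w _; rewrite /g patchE.
  by case: ifPn => wv; [rewrite mem_set|rewrite memNset //; exact/negP].
have mv : measurable [set w : R | w <= v].
  rewrite (_ : [set _ | _] = `]-oo, v]%classic); first exact: measurable_itv.
  by apply/seteqP; split=> w /=; rewrite in_itv.
apply: ge0_subset_integral => //.
- exact: measurableI.
- exact: mBE.
- by move=> x; rewrite /= in_itv /= => /andP[x0 xv]; rewrite lee_fin B_ge0 // x0; lra.
- by move=> w [/D01 /andP[w0 w1] /= wv]; rewrite in_itv /= wv ltW.
Qed.

End UniformShift.

(** * Construction of the optimal strategy *)

Section OptimalStrategy.
Context {R : realType}.
Implicit Types x w T : R.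

Lemma optimal_strategy_exists (s : R) : 0 < s <= 1 ->
  exists (d : measure_display) (Omega : measurableType d)
         (P : probability Omega R) (b : Omega -> int -> R),
    rand_strategy b /\ robust P b (rho_s s) /\ consistent P b (chi_s s).
Proof.
move=> s01; have [tau [f0 [P0 [/andP[t0 t1] piece df0 f01 f0le]]]] := initial_piece_chi s01.
case/andP: s01 => s0 s1.
have [f [fE fP]] := delay_pieces s0 piece.
set C := s * expR (- s).
have C0 : 0 < C by rewrite mulr_gt0 ?expR_gt0.
have CE : C^-1 = rho_s s by rewrite /C /rho_s invfM expRN invrK mulrC.
have fpos k x : 0 <= x <= 1 -> 0 < f k x by case: (fP k) => _ h _ _; exact: h.
have fpos0 k : 0 < f k 0 by apply: fpos; rewrite lexx ler01.
have df k x : is_derive x 1 (f k.+1) (C * f k x) by case: (fP k).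
have fglue k : f k.+1 1 = f k 0 by case: (fP k).
have cf k : continuous (f k) by case: (fP k).
have f0lt x y : x < y -> f 0%N x < f 0%N y.
  move=> xy; rewrite fE; apply: (is_derive_lt xy df0) => z _.
  exact: lt_le_trans (late_bid_ge1 _ _ _).
have flt k x y : 0 <= x -> x < y -> y <= 1 -> f k x < f k y.
  case: k => [|k] x0 xy y1; first exact: f0lt.
  apply: (is_derive_lt xy (df k)) => z /andP[xz zy].
  by rewrite mulr_gt0 // fpos //; apply/andP; split; lra.
have fle k x y : 0 <= x -> x <= y -> y <= 1 -> f k x <= f k y.
  move=> x0; rewrite le_eqVlt => /predU1P[->//|xy] y1; exact/ltW/flt.
have f0nn x : 0 <= x -> 0 < f 0%N x.
  rewrite le_eqVlt => /predU1P[<-|x0]; first exact: fpos0.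
  exact: lt_trans (fpos0 0%N) (f0lt _ _ x0).
(* The profile may jump at rank [0]: bids just below that rank approach [C * f 0 1], which must not
   exceed the bid [1] placed there. *)
have Cf01 : C * f 0%N 1 <= 1.
  apply: (@le_trans _ _ (C * (expR (s * (1 - tau)) / s))).
    by rewrite ler_pM2l // fE f0le.
  have -> : C * (expR (s * (1 - tau)) / s) = expR (- s) * expR (s * (1 - tau)).
    by rewrite /C; field; rewrite gt_eqF.
  rewrite -expRD expR_le1.
  have : 0 <= s * tau by rewrite mulr_ge0 // ltW.
  lra.
(* The value at [0] drops by at least [C * f k 0] from piece [k] to the next. As these values
   decrease, [k] drops of at least the last size fit into [f 0 0], so bids of very negative rank
   tend to [0]. *)
have fdecay k : k%:R * (C * f k 0) + f k 0 <= f 0%N 0.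
  elim: k => [|k IH]; first by rewrite mul0r add0r.
  have [c /andP[c0 c1]] := is_derive_mvt ltr01 (fun x _ => df k x).
  rewrite fglue subr0 mulr1 => E.
  have h1 : C * f k 0 <= C * f k c by rewrite ler_pM2l // fle // ltW.
  have h2 : 0 < C * f k 0 by rewrite mulr_gt0.
  have h3 : C * f k.+1 0 <= C * f k 0 by rewrite ler_pM2l //; lra.
  have h4 : k.+1%:R * (C * f k.+1 0) <= k.+1%:R * (C * f k 0) by rewrite ler_pM2l.
  apply: le_trans IH; move: h4; rewrite -[k.+1%:R]natr1 !mulrDl; lra.
have fsmall T : 0 < T -> exists k, C * f k 0 < T.
  move=> T0; pose k := Num.bound (f 0%N 0 / T).
  have kP : f 0%N 0 / T < k%:R.
    by apply: archi_boundP; rewrite divr_ge0 // ltW.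
  have k0 : 0 < k%:R :> R by apply: le_lt_trans kP; rewrite divr_ge0 // ltW.
  exists k; rewrite -(ltr_pM2l k0); apply: le_lt_trans (_ : _ <= f 0%N 0) _.
    by have := fdecay k; have := fpos0 k; lra.
  by rewrite -ltr_pdivrMr.
(* [Negz k] is [- k - 1], so [f k x = H (x - k)] is taken one unit after the rank [x - k - 1], as
   the delay equation with [C = 1 / rho_s s] demands. *)
pose B (n : int) x := match n with
  | Posz m => late_bid s tau (m%:R + x) | Negz k => C * f k x end.
pose Q (n : int) x := match n with
  | Posz m => f 0%N (m%:R + x) | Negz k => f k.+1 x end.
have NS k : Negz k.+1 + 1 = Negz k by lia.
have N0 : Negz 0 + 1 = 0 by lia.
have PS (m : nat) : Posz m + 1 = Posz m.+1 by lia.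
have dQ n x : is_derive x 1 (Q n) (B n x).
  case: n => [m|k] /=; last exact: df.
  by apply: is_derive_comp_shift; rewrite fE.
have cB n : continuous (B n).
  case: n => [m|k].
    have -> : B (Posz m) = late_bid s (tau - m%:R).
      by apply/funext => x; rewrite /= /late_bid; congr (expR (Num.max 0 _)); ring.
    exact: late_bid_continuous.
  by move=> x; apply: cvgMr; exact: cf.
have B_gt0' n x : 0 <= x <= 1 -> 0 < B n x.
  move=> x01; case: n => [m|k] /=; first exact: lt_le_trans (late_bid_ge1 _ _ _).
  by rewrite mulr_gt0 // fpos.
have B_ge0 n x : 0 <= x <= 1 -> 0 <= B n x by move=> /(B_gt0' n)/ltW.
have B_gt0 n x : 0 < x < 1 -> 0 < B n x.
  by move=> /andP[/ltW x0 /ltW x1]; apply: B_gt0'; rewrite x0.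
have Q_ge0 n x : 0 <= x <= 1 -> 0 <= Q n x.
  move=> x01; case: n => [m|k] /=; last exact/ltW/fpos.
  by apply/ltW/f0nn; rewrite addr_ge0 //; case/andP: x01.
have QS (n : int) : Q (n + 1) 0 = Q n 1.
  case: n => [m|[|k]].
  - by rewrite PS /= addr0 natr1.
  - by rewrite N0 /= addr0 fglue.
  - by rewrite NS /= fglue.
have B_lt n x : 0 < x < 1 -> B n x < B (n + 1) x.
  move=> /andP[x0 x1]; case: n => [m|[|k]].
  - rewrite PS /= /late_bid ltr_expR.
    have h : 0 < s * (m.+1%:R + x - tau).
      rewrite mulr_gt0 //; have : (0 : R) <= m%:R by [].
      by rewrite -[m.+1%:R]natr1; lra.
    rewrite [ltRHS]max_r ?(ltW h) // gt_max h /= -[m.+1%:R]natr1 ltr_pM2l //.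
    by lra.
  - rewrite N0 /=; apply: lt_le_trans (late_bid_ge1 _ _ _).
    by apply: lt_le_trans Cf01; rewrite ltr_pM2l // f0lt.
  - rewrite NS /= ltr_pM2l //; apply: (@lt_trans _ _ (f k 0)).
      by rewrite -fglue flt // ltW.
    by rewrite flt // ltW.
have B_small T : 0 < T -> exists n, forall x, 0 < x < 1 -> B n x < T.
  move=> /fsmall[k kT]; exists (Negz k.+1) => x /andP[x0 x1] /=.
  by apply: lt_trans kT; rewrite ltr_pM2l // -fglue flt // ltW.
pose cost_le := shift_rand_cost dQ cB B_ge0 Q_ge0 QS B_gt0 B_lt B_small.
(* Index [- 1] with [v = 1]: every shift succeeds at index [0] at the latest. *)
have cost1 T : 0 < T -> T <= 1 ->
    (rand_cost (uniform_prob (@ltr01 R)) (shift_strategy B) T <= (chi_s s)%:E)%E.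
  move=> T0 T1; have := cost_le T 1 (Negz 0) T0.
  rewrite ler01 lexx N0 /= add0r fE f01; apply=> // w /andP[w0 w1].
    by move=> _; exact: le_trans (late_bid_ge1 _ _ _).
  by move=> h; lra.
exists _, _, (uniform_prob (@ltr01 R)), (shift_strategy B).
split; first exact: (shift_rand_strategy cB B_gt0 B_lt).
split; last exact: cost1.
move=> T T0.
have [Tg|gT] := leP T (C * f 0%N 1).
  (* Such a target is the bid of rank [v - k - 1] for some [v], and the cost bound [f k v] is
     exactly [T / C]. *)
  have ex : exists k, C * f k 0 < T by exact: fsmall.
  case: (ex_minnP ex) => k kT kmin.
  have Tk : T <= C * f k 1.
    case: k kT kmin => [//|k] kT kmin; rewrite fglue leNgt; apply/negP => /kmin.
    by rewrite ltnn.
  have [| |v] := @IVT R (fun x => C * f k x) 0 1 T ler01.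
  - by apply: continuous_subspaceT => x; apply: cvgMr; exact: cf.
  - by rewrite ge_min le_max Tk (ltW kT) orbT.
  rewrite in_itv /= => /andP[v0 v1] vT.
  have := cost_le T v (Negz k) T0; rewrite v0 v1.
  have -> : Q (Negz k + 1) v = f k v.
    by case: (k) => [|j]; rewrite ?N0 ?NS //= add0r.
  have -> : rho_s s * T = f k v by rewrite -CE -vT mulKf // gt_eqF.
  apply=> // w /andP[w0 w1] wv; last first.
    by rewrite /= -vT ler_pM2l // fle // ltW.
  case: (k) Tk => [|j] Tk; rewrite ?N0 ?NS /=.
    exact: le_trans (le_trans Tk Cf01) (late_bid_ge1 _ _ _).
  by apply: le_trans Tk _; rewrite fglue ler_pM2l // fle // ltW.
(* Targets inside the jump share the bound [f 0 1 = chi_s s] of target [1], which is below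
   [T / C]. *)
have [T1|T1] := leP T 1.
  apply: le_trans (cost1 _ T0 T1) _; rewrite lee_fin -f01 -CE.
  by rewrite ler_pdivlMl // -fE ltW.
have lnT : 0 < ln T by rewrite ln_gt0.
(* [t] is the rank whose bid is [T]; the cost is at most [f 0 (t + 1)], itself at most
   [e^(s (t + 1 - tau)) / s = rho_s s * T]. *)
pose t := tau + ln T / s.
have t_ge0 : 0 <= t by rewrite addr_ge0 // divr_ge0 // ltW.
have /andP[mt tm] := truncn_itv t_ge0.
set m := Num.truncn t in mt tm.
have Tle x : t <= x -> T <= late_bid s tau x.
  move=> tx; have taux : tau <= x.
    by apply: le_trans tx; rewrite lerDl divr_ge0 // ltW.
  rewrite late_bid_right // -{1}(@lnK _ T) ?posrE // ler_expR mulrC -ler_pdivrMr //.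
  by move: tx; rewrite /t; lra.
have v0 : 0 <= t - m%:R by rewrite subr_ge0.
have v1 : t - m%:R <= 1 by move: tm; rewrite -[m.+1%:R]natr1; lra.
have := cost_le T (t - m%:R) (Posz m) T0; rewrite v0 v1 PS /=.
have -> : m.+1%:R + (t - m%:R) = t + 1 by rewrite -natr1; ring.
move=> h; apply: le_trans (h isT _ _) _.
- by move=> w /andP[w0 w1] _; apply: Tle; lra.
- by move=> w _ wv; apply: Tle; lra.
rewrite lee_fin fE; apply: le_trans (f0le _ _) _.
  by rewrite /t -addrA lerDl addr_ge0 // divr_ge0 // ltW.
rewrite /t (_ : s * (tau + ln T / s + 1 - tau) = s + ln T); last first.
  by field; rewrite gt_eqF.
by rewrite expRD lnK ?posrE // /rho_s mulrAC.
Qed.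

End OptimalStrategy.

Theorem theorem1 (R : realType) (s : R) :
  0 < s <= 1 ->
  (exists (d : measure_display) (Omega : measurableType d)
          (P : probability Omega R) (b : Omega -> int -> R),
      rand_strategy b /\ robust P b (rho_s s) /\ consistent P b (chi_s s)) /\
  (forall rho' : R, rho' < rho_s s ->
     forall (d : measure_display) (Omega : measurableType d)
            (P : probability Omega R) (b : Omega -> int -> R),
       rand_strategy b -> robust P b rho' -> ~ consistent P b (chi_s s)).
Proof.
move=> s01; split; first exact: optimal_strategy_exists.
by move=> rho' rho's d Omega P b; exact: no_better_robustness.
Qed.
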